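(* The set of all equilibrium prices is non-empty and convex. If $p$ is an equilibrium price, then every admissible price system $q$ satisfying $p^{\sharp\sharp}(z)\le q(z)\le p^{\flat\flat}(z)$ for all $z\in Z$ is also an equilibrium price. Moreover, if $(p,\alpha,\beta)$ is an equilibrium, then $p^{\sharp\sharp}(z)=p(z)=p^{\flat\flat}(z)$ for $\alpha_Z$-almost every (equivalently $\beta_Z$-almost every) $z\in Z_0$.
   Context: Standing setting. $X\subset\mathbb R^{d_1}$, $Y\subset\mathbb R^{d_2}$, $Z_0\subset\mathbb R^{d_3}$ are compact sets (possibly finite). $\mu$ and $\nu$ are finite nonnegative Borel measures on $X$ and $Y$ respectively (atoms allowed; $\mu(X)\neq\nu(Y)$ allowed). $u$ is a continuous real function on a neighbourhood of $X\times Z_0$ in $\mathbb R^{d_1+d_3}$, differentiable with respect to $x$ with $D_xu$ continuous in $(x,z)$; $v$ is a continuous real function on a neighbourhood of $Y\times Z_0$ in $\mathbb R^{d_2+d_3}$, differentiable with respect to $y$ with $D_yv$ continuous in $(y,z)$. Let $\varnothing_d\neq\varnothing_s$ be two points not in $Z_0$ and $Z=Z_0\cup\{\varnothing_d\}\cup\{\varnothing_s\}$ (a compact set in which the two added points are isolated). Extend $u,v$ by $u(x,\varnothing_d)=0$, $u(x,\varnothing_s)=-1$, $v(y,\varnothing_s)=0$, $v(y,\varnothing_d)=1$. Define $b(z)=\max_{x\in X}u(x,z)$, $a(z)=\min_{y\in Y}v(y,z)$ for $z\in Z$, and $Z_1=\{z\in Z: a(z)\le b(z)\}$. A price system is a continuous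 $p:Z\to\mathbb R$ with $p(\varnothing_d)=p(\varnothing_s)=0$; it is admissible if $a(z)\le p(z)\le b(z)$ for all $z\in Z_1$. Given a price system $p$: $p^\sharp(x)=\max_{z\in Z}\{u(x,z)-p(z)\}$, $p^\flat(y)=\min_{z\in Z}\{v(y,z)-p(z)\}$, $p^{\sharp\sharp}(z)=\sup_{x\in X}\{u(x,z)-p^\sharp(x)\}$, $p^{\flat\flat}(z)=\inf_{y\in Y}\{v(y,z)-p^\flat(y)\}$, $D(x)=\arg\max_{z\in Z}\{u(x,z)-p(z)\}$, $S(y)=\arg\min_{z\in Z}\{v(y,z)-p(z)\}$. A demand distribution associated with $p$ is a positive Borel measure $\alpha$ on $X\times Z$ carried by the graph of $D$ with marginal $\mu$ on $X$; a supply distribution is a positive Borel measure $\beta$ on $Y\times Z$ carried by the graph of $S$ with marginal $\nu$ on $Y$. $\alpha_Z,\beta_Z$ denote marginals on $Z$. An equilibrium is a triple $(p,\alpha,\beta)$ with $p$ an admissible price system, $\alpha,\beta$ demand and supply distributions associated with $p$, and $\alpha_Z(A)=\beta_Z(A)$ for every Borel $A\subset Z_0$. An equilibrium price is a price system $p$ for which there exist $\alpha,\beta$ making $(p,\alpha,\beta)$ an equilibrium. *)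

(* Defs.v *)
From HB Require Import structures.
From mathcomp Require Import all_boot all_order all_algebra.
From mathcomp Require Import all_classical all_reals all_analysis.
Set Implicit Arguments. Unset Strict Implicit. Unset Printing Implicit Defensive.
Import Order.TTheory GRing.Theory Num.Theory.
Import numFieldNormedType.Exports.
Local Open Scope classical_set_scope.
Local Open Scope ring_scope.

Definition borelType (T : topologicalType) := g_sigma_algebraType (@open T).

Section Market.
Variables (R : realType) (d1 d2 d3 : nat).
Notation V1 := 'rV[R]_d1.
Notation V2 := 'rV[R]_d2.
Notation V3 := 'rV[R]_d3.
Variables (X : set V1) (Y : set V2) (Z0 : set V3) (zd zs : V3).
Variables (u : V1 -> V3 -> R) (v : V2 -> V3 -> R).

Definition Zset : set V3 := Z0 `|` [set zd] `|` [set zs].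

Definition uext (x : V1) (z : V3) : R :=
  if z == zd then 0 else if z == zs then -1 else u x z.
Definition vext (y : V2) (z : V3) : R :=
  if z == zs then 0 else if z == zd then 1 else v y z.

(* b(z) = max_x u(x,z), a(z) = min_y v(y,z) (max/min written as sup/inf) *)
Definition bfun (z : V3) : R := sup [set uext x z | x in X].
Definition afun (z : V3) : R := inf [set vext y z | y in Y].
Definition Z1 : set V3 := [set z | Zset z /\ afun z <= bfun z].

Definition price_system (p : V3 -> R) : Prop :=
  {within Zset, continuous p} /\ p zd = 0 /\ p zs = 0.
Definition admissible (p : V3 -> R) : Prop :=
  price_system p /\ (forall z, Z1 z -> afun z <= p z <= bfun z).

Definition psharp (p : V3 -> R) (x : V1) : R :=
  sup [set uext x z - p z | z in Zset].
Definition pflat (p : V3 -> R) (y : V2) : R :=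
  inf [set vext y z - p z | z in Zset].
Definition psharpsharp (p : V3 -> R) (z : V3) : R :=
  sup [set uext x z - psharp p x | x in X].
Definition pflatflat (p : V3 -> R) (z : V3) : R :=
  inf [set vext y z - pflat p y | y in Y].

Definition Dcorr (p : V3 -> R) (x : V1) : set V3 :=
  [set z | Zset z /\ forall z', Zset z' -> uext x z' - p z' <= uext x z - p z].
Definition Scorr (p : V3 -> R) (y : V2) : set V3 :=
  [set z | Zset z /\ forall z', Zset z' -> vext y z - p z <= vext y z' - p z'].

Definition graphD (p : V3 -> R) : set (V1 * V3) :=
  [set xz | X xz.1 /\ Dcorr p xz.1 xz.2].
Definition graphS (p : V3 -> R) : set (V2 * V3) :=
  [set yz | Y yz.1 /\ Scorr p yz.1 yz.2].

Definition demand_distribution (mu : {measure set (borelType V1) -> \bar R})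
  (p : V3 -> R) (alpha : {measure set (borelType (V1 * V3)%type) -> \bar R}) : Prop :=
  alpha.-negligible (~` (graphD p : set (borelType (V1 * V3)%type))) /\
  (forall A : set (borelType V1), measurable A ->
     alpha ((A `*` [set: V3]) : set (borelType (V1 * V3)%type)) = mu A).

Definition supply_distribution (nu : {measure set (borelType V2) -> \bar R})
  (p : V3 -> R) (beta : {measure set (borelType (V2 * V3)%type) -> \bar R}) : Prop :=
  beta.-negligible (~` (graphS p : set (borelType (V2 * V3)%type))) /\
  (forall A : set (borelType V2), measurable A ->
     beta ((A `*` [set: V3]) : set (borelType (V2 * V3)%type)) = nu A).

Definition alphaZ (alpha : {measure set (borelType (V1 * V3)%type) -> \bar R})
  (A : set V3) : \bar R := alpha (([set: V1] `*` A) : set (borelType (V1 * V3)%type)).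
Definition betaZ (beta : {measure set (borelType (V2 * V3)%type) -> \bar R})
  (A : set V3) : \bar R := beta (([set: V2] `*` A) : set (borelType (V2 * V3)%type)).

Definition equilibrium mu nu (p : V3 -> R) alpha beta : Prop :=
  [/\ admissible p, demand_distribution mu p alpha, supply_distribution nu p beta &
      forall A : set (borelType V3), measurable A -> A `<=` Z0 ->
        alphaZ alpha A = betaZ beta A].

Definition equilibrium_price mu nu (p : V3 -> R) : Prop :=
  exists alpha beta, equilibrium mu nu p alpha beta.

Definition ae_on_Z0 (m : set V3 -> \bar R) (P : V3 -> Prop) : Prop :=
  exists N : set (borelType V3), [/\ measurable N,
    [set z | Z0 z /\ ~ P z] `<=` N & m N = 0%E].

Definition regular_u : Prop :=
  exists U : set (V1 * V3), [/\ open U, X `*` Z0 `<=` U,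
    (forall xz, U xz -> {for xz, continuous (fun w : V1 * V3 => u w.1 w.2)}),
    (forall xz, U xz -> differentiable (fun x : V1 => u x xz.2) (xz.1 : V1)) &
    (forall (h : V1) xz, U xz ->
       {for xz, continuous (fun w : V1 * V3 => ('d (fun x : V1 => u x w.2) (w.1 : V1) : V1 -> R) h)})].
Definition regular_v : Prop :=
  exists U : set (V2 * V3), [/\ open U, Y `*` Z0 `<=` U,
    (forall yz, U yz -> {for yz, continuous (fun w : V2 * V3 => v w.1 w.2)}),
    (forall yz, U yz -> differentiable (fun y : V2 => v y yz.2) (yz.1 : V2)) &
    (forall (h : V2) yz, U yz ->
       {for yz, continuous (fun w : V2 * V3 => ('d (fun y : V2 => v y w.2) (w.1 : V2) : V2 -> R) h)})].

End Market.

(* Main.v *)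
Require Import Defs.
From HB Require Import structures.
From mathcomp Require Import all_boot all_order all_algebra.
From mathcomp Require Import all_classical all_reals all_analysis.
From mathcomp Require Import ring lra measurable_realfun.
Set Implicit Arguments. Unset Strict Implicit. Unset Printing Implicit Defensive.
Import Order.TTheory GRing.Theory Num.Theory.
Import numFieldNormedType.Exports.
Local Open Scope classical_set_scope.
Local Open Scope ring_scope.

(** The existence of an equilibrium price is obtained by discretisation. For finitely
    many agents the market is an assignment game with surplus
    [s x y = max_z (u x z - v y z)]; minimising its dual with a quadratic penalty
    gives utilities [phi], [psi] and a matching that satisfy complementary slackness
    up to [e], and [P z = max (a z) (max_x (u x z - phi x))] is then an approximate
    equilibrium price. As [e] tends to 0 along a free ultrafilter the prices converge,
    being equicontinuous, and the discrete trade measures converge to the image of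
    their Loeb measure by the standard part map, so that all support conditions pass
    to the limit.

    Convexity rests on the fact that distributions and prices of two equilibria can be
    interchanged: on the graph of [D_p] the gap [q^# x - (u x z - q z)] equals
    [(q^# - p^#) x + (q - p) z], so the four mean gaps are nonnegative and add up to 0.
    The other two claims follow because [p^##] and [p] (resp. [p^bb] and [p]) agree on
    the compact projection of the graph of [D_p] (resp. [S_p]). *)

(** * Ultrafilters and Loeb measures *)

(** Trades are recorded by a single measure on triples (buyer, seller, good) instead of two separate
    distributions. Demand and supply are images of its restrictions to [z <> zs] and [z <> zd], and
    both restrictions are vacuous on [Z0], so the market clears at every stage and in the limit. An
    unmatched buyer is entered with [zd] and a fixed seller, an unmatched seller with [zs] and a
    fixed buyer; each restriction removes the entries made only for the other side. This also
    accommodates unequal total masses.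

    The discrete trade measures enter the limit merely as bounded finitely additive set functions on
    all subsets. Saturation of the internal sets alone turns their ultralimit into a countably
    additive measure, and its image under the standard part is Borel, so neither weak compactness
    nor a representation theorem is invoked. *)

Lemma ultra_fmap (S T : Type) (f : S -> T) (U : set_system S) :
  UltraFilter U -> UltraFilter (f @ U).
Proof.
move=> UU; split; first exact: fmap_proper_filter.
move=> G PG UG; apply/seteqP; split=> //.
move=> A GA; have [//|UnA] := in_ultra_setVsetC (f @^-1` A) UU.
have : G (A `&` ~` A) by apply: filterI => //; exact: UG.
by rewrite setICr => /filter_not_empty.
Qed.

Lemma ultra_compact_cvg (S : Type) (T : topologicalType) (K : set T)
    (U : set_system S) (f : S -> T) :
  UltraFilter U -> compact K -> (\forall s \near U, K (f s)) ->
  exists2 t, K t & f @ U --> t.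
Proof.
move=> UU; rewrite compact_ultra => cK KU.
by have [t [Kt ft]] := cK _ (ultra_fmap f UU) KU; exists t.
Qed.

Lemma free_ultrafilter : exists U : set_system nat, UltraFilter U /\ \oo `<=` U.
Proof. exact: ultraFilterLemma. Qed.

Section ultralimit.
Context (R : realType) (S : Type) (U : set_system S) (UU : UltraFilter U).

Lemma ultra_bounded_cvg (f : S -> R) a b :
  (forall s, a <= f s <= b) -> f @ U --> lim (f @ U).
Proof.
move=> fab.
have [|t _ ft] := ultra_compact_cvg UU (@segment_compact R a b) (f := f).
  by apply: nearW => s /=; rewrite in_itv/= fab.
by move/cvg_lim : (ft) => -> //; exact: norm_hausdorff.
Qed.

End ultralimit.

(** Internal sets of the ultrapower, kept on raw sequences: each is a union of classes modulo
    [U]-almost everywhere equality, so the quotient never has to be formed. *)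
Definition internal (U : set_system nat) (T : Type) (S : nat -> set T) :
  set (nat -> T) := [set w | U [set n | S n (w n)]].

Section internal_sets.
Context (U : set_system nat) (UU : UltraFilter U) (T : pointedType).
Implicit Types S : nat -> set T.

Lemma internalC S : internal U (fun n => ~` S n) = ~` internal U S.
Proof.
apply/seteqP; split=> w.
  move=> Cw Sw; apply: (@filter_not_empty _ U).
  by apply: filterS (filterI Cw Sw) => n [].
by move=> nSw; have [] := in_ultra_setVsetC [set n | S n (w n)] UU.
Qed.

Lemma internalI S1 S2 :
  internal U (fun n => S1 n `&` S2 n) = internal U S1 `&` internal U S2.
Proof.
apply/seteqP; split=> w.
  by move=> Sw; split; apply: filterS Sw => n [].
by move=> [S1w S2w]; apply: filterI.
Qed.

Lemma internalU S1 S2 :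
  internal U (fun n => S1 n `|` S2 n) = internal U S1 `|` internal U S2.
Proof.
apply: setC_inj; rewrite -internalC setCU -!internalC -internalI.
by congr internal; apply/funext => n; rewrite setCU.
Qed.

Lemma internal0 : internal U (fun=> set0 : set T) = set0.
Proof.
by apply/seteqP; split=> w // Uw; exact: (@filter_not_empty _ U).
Qed.

Lemma internal_bigsetU S (k : nat -> nat -> set T) m :
  internal U (fun n => \big[setU/set0]_(i < m) k i n)
  = \big[setU/set0]_(i < m) internal U (k i).
Proof.
elim: m => [|m IH].
  rewrite big_ord0 -internal0; congr internal.
  by apply/funext => n; rewrite big_ord0.
rewrite big_ord_recr/= -IH -internalU; congr internal.
by apply/funext => n; rewrite big_ord_recr.
Qed.

(** If the inclusion failed for [U]-most [n], a choice of points in [S1 n] outside [S2 n] would be a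
    sequence lying in one internal set and not in the other. *)
Lemma internal_subset S1 S2 : internal U S1 `<=` internal U S2 ->
  \forall n \near U, S1 n `<=` S2 n.
Proof.
move=> S12; set B := [set n | S1 n `<=` S2 n].
have [//|UnB] := in_ultra_setVsetC B UU.
pose w n := xget point (S1 n `\` S2 n).
have Uw : \forall n \near U, (S1 n `\` S2 n) (w n).
  apply: filterS UnB => n /= nB.
  have [x xS] : S1 n `\` S2 n !=set0.
    apply/set0P/negP => /eqP S0; apply: nB => x S1x.
    by apply: contrapT => S2x; have : (S1 n `\` S2 n) x by []; rewrite S0.
  exact: (xgetI point xS).
have : internal U S2 w by apply: S12; apply: filterS Uw => n [].
move=> S2w; exfalso; apply: (@filter_not_empty _ U).
by apply: filterS (filterI Uw S2w) => n [[]].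
Qed.

(* Countable saturation: the witness follows, at rank n, the deepest finite
   stage of the covering that still leaves a point of S n uncovered. *)
Lemma internal_cover S (F : nat -> nat -> set T) : \oo `<=` U ->
  internal U S `<=` \bigcup_i internal U (F i) ->
  exists m, internal U S `<=` \big[setU/set0]_(i < m) internal U (F i).
Proof.
move=> ooU SF; apply: contrapT => /forallNP nSF.
pose D n m := S n `\` \big[setU/set0]_(i < m) F i n.
have decD n m k : (m <= k)%N -> D n k `<=` D n m.
  move=> mk x [Sx nFx]; split=> //; apply: contra_not nFx.
  rewrite -!(bigcup_mkord _ (F^~ n)) => -[i /= im Fi].
  by exists i => //=; exact: leq_trans mk.
have UD m : \forall n \near U, D n m !=set0.
  set B := [set n | D n m !=set0].
  have [//|UnB] := in_ultra_setVsetC B UU.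
  exfalso; apply: (nSF m) => w Sw.
  rewrite -(internal_bigsetU S); apply: filterS (filterI Sw UnB) => n [/= Sn nB].
  by apply: contrapT => nF; apply: nB; exists (w n).
have exw n : exists x, forall m, (m <= n)%N -> D n m !=set0 -> D n m x.
  suff : forall k, exists x, forall m, (m <= k)%N -> D n m !=set0 -> D n m x.
    exact.
  elim=> [|k [x IH]].
    have [[y Dy]|nD] := pselect (D n 0%N !=set0).
      by exists y => m; rewrite leqn0 => /eqP ->.
    by exists point => m; rewrite leqn0 => /eqP ->.
  have [[y Dy]|nD] := pselect (D n k.+1 !=set0).
    by exists y => m mk _; exact: decD Dy.
  by exists x => m; rewrite leq_eqVlt => /predU1P[->//|]; exact: IH.
have [w Hw] := choice exw.
have Uw m : \forall n \near U, D n m (w n).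
  (* Freeness of [U] enters here: the witness of rank [n] is tied to stage [m] only once
     [m <= n]. *)
  have Um : \forall n \near U, (m <= n)%N by apply: ooU; exact: nbhs_infty_ge.
  by apply: filterS (filterI Um (UD m)) => n [/= mn Dm]; exact: Hw.
have [|i _ Fi] := SF w; first by apply: filterS (Uw 0%N) => n [].
apply: (@filter_not_empty _ U).
apply: filterS (filterI (Uw i.+1) Fi) => n [/= [_ nF] Fin]; apply: nF.
by rewrite -(bigcup_mkord _ (F^~ n)); exists i => /=.
Qed.

End internal_sets.

(** * The Loeb measure of a bounded sequence of finitely additive set functions *)

Section loeb_measure.
Context (R : realType) (T : pointedType) (U : set_system nat) (UU : UltraFilter U).
Hypothesis ooU : \oo `<=` U.
Variables (th : nat -> set T -> R) (M : R).
Hypothesis th_ge0 : forall n A, 0 <= th n A.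
Hypothesis thU : forall n A B, A `&` B = set0 -> th n (A `|` B) = th n A + th n B.
Hypothesis th_le : forall n, th n setT <= M.

Let th0 n : th n set0 = 0.
Proof.
by have := thU n (setI0 set0); rewrite setU0; lra.
Qed.

Let th_sub n A B : A `<=` B -> th n A <= th n B.
Proof.
move=> AB; rewrite -(setDUK AB) thU ?lerDl//.
by rewrite setDE setICA setICr setI0.
Qed.

Let th_bounded (S : nat -> set T) n : 0 <= th n (S n) <= M.
Proof. by rewrite th_ge0/= (le_trans _ (th_le n))//; exact: th_sub. Qed.

Let ulim (S : nat -> set T) : R := lim (th n (S n) @[n --> U]).

Let ulim_cvg S : th n (S n) @[n --> U] --> ulim S.
Proof. exact: ultra_bounded_cvg (th_bounded S). Qed.

Let ulim_le S1 S2 : (\forall n \near U, S1 n `<=` S2 n) -> ulim S1 <= ulim S2.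
Proof.
move=> S12; apply: (ler_cvg_to (@ulim_cvg S1) (@ulim_cvg S2)).
by apply: filterS S12 => n; exact: th_sub.
Qed.

Definition sequences_of := nat -> T.
HB.instance Definition _ := Pointed.on sequences_of.

Definition internal_set (A : set sequences_of) := exists S, A = internal U S.

Let internal_set0 : internal_set set0.
Proof. by exists (fun=> set0); rewrite internal0. Qed.

Let internal_setU : setU_closed internal_set.
Proof.
move=> _ _ [S1 ->] [S2 ->]; exists (fun n => S1 n `|` S2 n).
by rewrite internalU.
Qed.

Let internal_setC : setC_closed internal_set.
Proof. by move=> _ [S ->]; exists (fun n => ~` S n); rewrite internalC. Qed.

Definition internal_display := default_measure_display.

HB.instance Definition _ := @isAlgebraOfSets.Build internal_display sequences_of
  internal_set internal_set0 internal_setU internal_setC.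

(** An internal set has many representing sequences. One is picked, with empty sets as default off
    the internal sets; [loebE] shows that the value is independent of the choice, since two
    representations agree for [U]-most [n]. *)
Definition loeb (A : set sequences_of) : \bar R :=
  (lim (th n (xget (fun=> set0) [set S | A = internal U S] n) @[n --> U]))%:E.

Lemma loebE S : loeb (internal U S) = (ulim S)%:E.
Proof.
rewrite /loeb; set S' := xget _ _.
have SS' : internal U S = internal U S'.
  rewrite /S'; case: xgetP => [S'' _ SS''|nS]; first exact: SS''.
  by have := nS S erefl.
rewrite -/(ulim S'); congr EFin; apply/eqP; rewrite eq_le.
by apply/andP; split; apply: ulim_le; apply: internal_subset; rewrite SS'.
Qed.

Let loeb_ge0 A : (0 <= loeb A)%E.
Proof.
rewrite lee_fin; apply: limr_ge; last by apply: nearW => n; exact: th_ge0.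
by apply: cvgP; exact: ultra_bounded_cvg (th_bounded _).
Qed.

Let loeb0 : loeb set0 = 0%E.
Proof.
rewrite -(internal0 UU) loebE; congr EFin.
by apply/cvg_lim => //; under eq_fun do rewrite th0; exact: cvg_cst.
Qed.

Let loeb_semi_additive : measure_function.semi_additive loeb.
Proof.
apply/(additive2P loeb0) => _ _ [S1 ->] [S2 ->] S12.
rewrite -internalU// !loebE -EFinD; congr EFin; apply/cvg_lim => //.
have : th n (S1 n) + th n (S2 n) @[n --> U] --> ulim S1 + ulim S2.
  exact: cvgD (@ulim_cvg S1) (@ulim_cvg S2).
apply: cvg_trans; apply: near_eq_cvg.
have : internal U (fun n => S1 n `&` S2 n) `<=` internal U (fun=> set0).
  by rewrite internalI S12.
move=> /internal_subset; apply: filterS => n; rewrite subset0.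
by move=> /thU ->.
Qed.

HB.instance Definition _ := isContent.Build _ _ R loeb
  loeb_ge0 loeb_semi_additive.

(** By saturation, finitely many members of a countable internal cover already cover, so finite
    subadditivity yields the hypothesis of the Caratheodory extension. *)
Let loeb_sigma_subadditive : measurable_subset_sigma_subadditive loeb.
Proof.
move=> _ F /choice[S FS] [S0 ->] SF.
have {}FS : F = (fun i => internal U (S i)) by apply/funext.
move: SF; rewrite FS => SF; have [m mS] := internal_cover UU ooU SF.
have Sm : (internal U S0 : set sequences_of) `<=`
    \big[setU/set0]_(i < m) (internal U (S i) : set sequences_of) by [].
apply: le_trans (content_subadditive loeb _ _ Sm) _.
- by move=> i _; exists (S i).
- by exists S0.
rewrite -(big_mkord predT (fun i => loeb (internal U (S i)))).
by apply: (nneseries_lim_ge m) => i _ _; exact: loeb_ge0.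
Qed.

HB.instance Definition _ := Content_SigmaSubAdditive_isMeasure.Build _ R _ loeb
  loeb_sigma_subadditive.

Lemma loeb_measure_exists : exists m : {measure set
    (g_sigma_algebraType (internal_set)) -> \bar R},
  forall S, m (internal U S) = (ulim S)%:E.
Proof.
exists (measure_extension loeb) => S.
by rewrite -loebE; apply: (measurable_mu_extE loeb); exists S.
Qed.

End loeb_measure.

(* The limit measure is the image of the Loeb measure by the standard part map
   [w |-> lim w]; its closed-set inequality is a portmanteau theorem in which the
   sets may also vary along the sequence. *)
Lemma limit_measure (R : realType) (T : normedModType R) (U : set_system nat)
    (K : set T) (th : nat -> set T -> R) (M : R) :
  UltraFilter U -> \oo `<=` U -> compact K -> K !=set0 ->
  (forall n A, 0 <= th n A) ->
  (forall n A B, A `&` B = set0 -> th n (A `|` B) = th n A + th n B) ->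
  (forall n, th n setT <= M) ->
  (forall n, th n (~` K) = 0) ->
  exists Th : {measure set (borelType T) -> \bar R},
    Th setT = (lim (th n setT @[n --> U]))%:E /\
    forall (C : set (borelType T)) (S : nat -> set T), measurable C ->
      (forall w t, (forall n, K (w n)) -> (\forall n \near U, S n (w n)) ->
        w @ U --> t -> C t) ->
      ((lim (th n (S n) @[n --> U]))%:E <= Th C)%E.
Proof.
move=> UU ooU cK [k0 Kk0] th_ge0 thU th_le thK.
have FU : Filter U by exact: filter_filter.
have [m mE] := loeb_measure_exists UU ooU th_ge0 thU th_le.
(* Points outside [K] are sent to [k0], so that every sequence has a standard part in [K]; no mass
   is affected, as [th n] vanishes off [K]. *)
pose r t := if t \in K then t else k0.
have Kr t : K (r t) by rewrite /r; case: ifPn => // /set_mem.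
have rK t : K t -> r t = t by rewrite /r => /mem_set ->.
pose st (w : nat -> T) : T := lim ((r \o w) @ U).
have stP w : (r \o w) @ U --> st w.
  have [|t _ wt] := ultra_compact_cvg UU cK (f := r \o w).
    by apply: nearW => n /=.
  by rewrite /st; move/cvg_lim : (wt) => -> //; exact: norm_hausdorff.
have mst : measurable_fun setT
    (st : g_sigma_algebraType (internal_set U (T := T)) -> borelType T).
  apply: (@measurability _ _ (g_sigma_algebraType (internal_set U (T := T)))
    (borelType T) setT st (@open T)) => // _ [G oG <-]; rewrite setTI.
  (* The standard part lies in the open set [G] exactly when, for some [k], the balls of radius
     [1/(k+1)] around [U]-most terms lie in [G]. This exhibits the preimage as a countable union of
     internal sets. *)
  pose Gk k := [set t | ball (r t) k.+1%:R^-1 `<=` G].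
  rewrite (_ : _ @^-1` _ = \bigcup_k internal U (fun=> Gk k)).
    by apply: bigcup_measurable => k _; apply: sub_sigma_algebra; exists (fun=> Gk k).
  apply/seteqP; split=> w /=.
    move=> Gw; have /nbhs_ballP[e /= e0 eG] := open_nbhs_nbhs (conj oG Gw).
    have [k ke] := ltr_add_invr (divr_gt0 e0 (ltr0Sn R 1)).
    exists k => //.
    have e20 : 0 < e / 2 by rewrite divr_gt0.
    have stw : \forall n \near U, `|st w - r (w n)| < e / 2.
      exact: (cvgr_dist_lt _ _ (stP w)).
    suff : \forall n \near U, Gk k (w n) by [].
    apply: filterS stw => n /= wn t tn; apply: eG.
    have tn2 : ball (r (w n)) (e / 2) t.
      by apply: le_ball tn; apply: ltW; rewrite add0r in ke.
    rewrite (splitr e); apply: ball_triangle tn2.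
    by rewrite -ball_normE /=.
  move=> [k _ Gw].
  have k0' : 0 < k.+1%:R^-1 :> R by rewrite invr_gt0.
  have wn : \forall n \near U, `|st w - r (w n)| < k.+1%:R^-1.
    exact: (cvgr_dist_lt _ _ (stP w)).
  have {}Gw : \forall n \near U, Gk k (w n) by [].
  have [n [/= Gn dn]] := filter_ex (filterI Gw wn).
  by apply: Gn; rewrite -ball_normE /= distrC.
exists (measure_function_pushforward__canonical__measure_function_Measure m mst); split.
  rewrite /= /pushforward preimage_setT -(mE (fun=> setT)); congr (m _).
  by apply/seteqP; split=> // w _; apply: filterS filterT.
move=> C S mC SC /=.
(* Cutting [S n] down to [K] costs no mass and makes [r] the identity on the terms of the sequences
   involved. *)
have -> : lim (th n (S n) @[n --> U]) = lim (th n (S n `&` K) @[n --> U]).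
  congr (lim (_ @ U)); apply/funext => n.
  rewrite -{1}(setUIDK (S n) K) thU; last by rewrite setDE setIACA setICr setI0.
  rewrite [X in _ + X](_ : _ = 0) ?addr0//.
  apply/eqP; rewrite eq_le th_ge0 andbT -[leRHS](thK n).
  have -> : ~` K = (S n `\` K) `|` (~` K `\` S n).
    apply/seteqP; split=> t /=; last by case=> -[].
    by move=> Kt; have [?|?] := pselect (S n t); [left|right].
  rewrite thU ?lerDl//; apply/seteqP; split=> // t [[/= ? ?] []] //.
rewrite -mE; apply: le_measure; rewrite ?inE.
- by apply: sub_sigma_algebra; exists (fun n => S n `&` K).
- by rewrite -[X in measurable X]setTI; exact: mst.
- move=> w Sw /=; apply: (SC (r \o w)); last exact: stP.
    by move=> n /=.
  by apply: filterS Sw => n [/= Sn Kn]; rewrite /= rK.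
Qed.

(** * The regularised assignment problem *)

Definition pospart (R : realDomainType) (x : R) : R := Num.max 0 x.

Section pospart.
Context (R : realFieldType).
Implicit Types a b c t x : R.

Lemma pospart_ge0 x : 0 <= pospart x.
Proof. by rewrite le_max lexx. Qed.

Lemma ge_pospart x : x <= pospart x.
Proof. by rewrite le_max lexx orbT. Qed.

(** The quadratic upper bound for the square of the positive part, whose derivative [2 * pospart a]
    is 2-Lipschitz. It takes the place of differentiation in the first-order conditions. *)
Lemma pospart_sqrB a t :
  pospart (a - t) ^+ 2 <= pospart a ^+ 2 - 2 * t * pospart a + t ^+ 2.
Proof.
by rewrite /pospart; case: (ltP 0 a) => a0; case: (ltP 0 (a - t)) => at0; nra.
Qed.

(** Dividing by [t] and letting [t] tend to 0 leaves [c]; this is how one-sided optimality is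
    exploited. *)
Lemma ge0_of_quadratic c C d : 0 < d -> 0 <= C ->
  (forall t, 0 < t <= d -> 0 <= t * c + t ^+ 2 * C) -> 0 <= c.
Proof.
move=> d0 C0 H; rewrite leNgt; apply/negP => c0.
pose t := Num.min d (- c / (2 * (C + 1))).
have t0 : 0 < t by rewrite lt_min d0 divr_gt0//; lra.
have td : t <= d by rewrite ge_min lexx.
have tC : t * (2 * (C + 1)) <= - c.
  by rewrite -ler_pdivlMr ?ge_min ?lexx ?orbT//; lra.
have := H t; rewrite t0 td => /(_ isT); nra.
Qed.

(** The objective has derivative [m - \sum_j pospart (b j - y) / e]. A step to the right gives the
    inequality; it is available unless [x = S], where every penalty vanishes because [b j <= S]. A
    step to the left is available when [0 < x] and gives the equality. *)
Lemma pospart_penalty_min k (b : 'I_k -> R) m e S x : 0 < e -> 0 <= m ->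
  0 <= x <= S -> (forall j, b j <= S) ->
  (forall y, 0 <= y <= S ->
    m * x + \sum_j pospart (b j - x) ^+ 2 / (2 * e) <=
    m * y + \sum_j pospart (b j - y) ^+ 2 / (2 * e)) ->
  \sum_j pospart (b j - x) / e <= m /\
  (0 < x -> \sum_j pospart (b j - x) / e = m).
Proof.
move=> e0 m0 /andP[x0 xS] bS minx; set c := \sum_j _.
have step t : 0 <= x + t <= S ->
    0 <= t * (m - c) + t ^+ 2 * (k%:R / (2 * e)).
  move=> /minx H.
  have le_sum : \sum_j pospart (b j - (x + t)) ^+ 2 / (2 * e) <=
      \sum_j pospart (b j - x) ^+ 2 / (2 * e) - t * c + t ^+ 2 * (k%:R / (2 * e)).
    have -> : t ^+ 2 * (k%:R / (2 * e)) = \sum_(j < k) t ^+ 2 / (2 * e).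
      by rewrite sumr_const card_ord -mulr_natr; field; lra.
    rewrite /c mulr_sumr -sumrB -big_split/=; apply: ler_sum => j _.
    rewrite opprD addrA.
    have -> : t * (pospart (b j - x) / e) = 2 * t * pospart (b j - x) / (2 * e).
      by field; lra.
    rewrite -mulrBl -mulrDl ler_pM2r ?invr_gt0 ?mulr_gt0//.
    exact: pospart_sqrB.
  by lra.
have C0 : 0 <= k%:R / (2 * e) :> R by rewrite divr_ge0//; lra.
have cm : c <= m.
  have [xltS|] := ltP x S.
    rewrite -subr_ge0; apply: (@ge0_of_quadratic _ (k%:R / (2 * e)) (S - x)) => //.
      by lra.
    by move=> t /andP[t0 tS]; apply: step; lra.
  move=> Sx; rewrite /c big1// => j _.
  by rewrite /pospart max_l ?mul0r// subr_le0 (le_trans (bS j)).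
split=> // xgt0; apply/eqP; rewrite eq_le cm/= -subr_ge0.
apply: (@ge0_of_quadratic _ (k%:R / (2 * e)) x) => //.
move=> t /andP[t0 tx]; have := step (- t); rewrite sqrrN mulNr -mulrN opprB.
by apply; lra.
Qed.

End pospart.

(* The quadratic penalty makes the first-order conditions at a minimiser read as
   the primal constraints and the complementary slackness relations of the
   assignment problem, with primal variable [pospart (s - phi - psi) / e]. *)
Lemma regularized_assignment (R : realType) m k (mu : 'I_m -> R) (nu : 'I_k -> R)
    (s : 'I_m -> 'I_k -> R) (e : R) :
  0 < e -> (forall i, 0 <= mu i) -> (forall j, 0 <= nu j) ->
  exists (phi : 'I_m -> R) (psi : 'I_k -> R),
    let g i j := pospart (s i j - phi i - psi j) / e in
    [/\ forall i, 0 <= phi i, forall j, 0 <= psi j,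
        forall i, \sum_j g i j <= mu i /\ (0 < phi i -> \sum_j g i j = mu i) &
        forall j, \sum_i g i j <= nu j /\ (0 < psi j -> \sum_i g i j = nu j)].
Proof.
move=> e0 mu0 nu0.
(* [S] bounds every surplus. Confining [phi] and [psi] to [[0, S]] makes a minimiser exist, and the
   upper bound adds no multiplier, since [s i j - psi j <= S] when [0 <= psi j]. *)
pose S := \sum_i \sum_j `|s i j|.
have sS i j : s i j <= S.
  rewrite (le_trans (ler_norm _))// /S (bigD1 i)//= (bigD1 j)//= -addrA lerDl.
  by rewrite addr_ge0 ?sumr_ge0// => *; rewrite sumr_ge0.
have S0 : 0 <= S by rewrite sumr_ge0// => *; rewrite sumr_ge0.
pose pen i j (w : 'rV[R]_m * 'rV[R]_k) :=
  pospart (s i j - w.1 ord0 i - w.2 ord0 j) ^+ 2 / (2 * e).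
pose F (w : 'rV[R]_m * 'rV[R]_k) := \sum_i mu i * w.1 ord0 i +
  \sum_j nu j * w.2 ord0 j + \sum_i \sum_j pen i j w.
pose box n := [set v : 'rV[R]_n | forall i, `[0, S]%classic (v ord0 i)].
have box0 n : box n (const_mx 0) by move=> i /=; rewrite mxE in_itv/= lexx.
have cbox : compact (box m `*` box k).
  by apply: compact_setX; apply: (@rV_compact R _ (fun=> `[0, S]%classic)) => i;
    exact: segment_compact.
have c1 i : continuous (fun w : 'rV[R]_m * 'rV[R]_k => w.1 ord0 i).
  move=> w; apply: (@continuous_comp _ _ _ fst (fun v : 'rV[R]_m => v ord0 i)).
    exact: cvg_fst.
  exact: coord_continuous.
have c2 j : continuous (fun w : 'rV[R]_m * 'rV[R]_k => w.2 ord0 j).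
  move=> w; apply: (@continuous_comp _ _ _ snd (fun v : 'rV[R]_k => v ord0 j)).
    exact: cvg_snd.
  exact: coord_continuous.
have cpos : continuous (@pospart R).
  have -> : @pospart R = (fun x => (x + `|x|) / 2).
    apply/funext => x; rewrite /pospart; case: (ltP 0 x) => x0.
      by rewrite gtr0_norm//; lra.
    by rewrite ler0_norm//; lra.
  move=> x; apply: cvgMr_tmp; apply: cvgD; first exact: cvg_id.
  exact: norm_continuous.
have csum n (f : 'I_n -> 'rV[R]_m * 'rV[R]_k -> R) :
    (forall i, continuous (f i)) -> continuous (fun w => \sum_i f i w).
  elim: n f => [f _|n IH f cf].
    rewrite (_ : (fun w => _) = fun=> 0); first by move=> w; exact: cvg_cst.
    by apply/funext => w; rewrite big_ord0.
  rewrite (_ : (fun w => _) = (fun w => \sum_(i < n) f (widen_ord (leqnSn n) i) w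
    + f ord_max w)); last by apply/funext => w; rewrite big_ord_recr.
  by move=> w; apply: cvgD; [apply: IH => i; exact: cf|exact: cf].
have cF : continuous F.
  move=> w; apply: cvgD; first apply: cvgD.
  - by apply: csum => i {}w; apply: cvgMl_tmp; exact: c1.
  - by apply: csum => j {}w; apply: cvgMl_tmp; exact: c2.
  - apply: (csum) => i; apply: csum => j {}w; apply: cvgMr_tmp.
    apply: (@continuous_comp _ _ _
      (fun w : 'rV[R]_m * 'rV[R]_k => s i j - w.1 ord0 i - w.2 ord0 j)
      (fun x : R => pospart x ^+ 2) w).
      apply: cvgB; last exact: c2.
      by apply: cvgB; [exact: cvg_cst|exact: c1].
    by move=> ?; apply: cvgM; exact: cpos.
(* With one block of variables frozen, the objective is a sum of one-variable functions [h]; moving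
   a single coordinate then isolates its own term. *)
have sep n (h : 'I_n -> R -> R) (p : 'rV[R]_n) i y :
    \sum_i' h i' (p ord0 i') <=
    \sum_i' h i' ((\row_i' (if i' == i then y else p ord0 i')) ord0 i') ->
    h i (p ord0 i) <= h i y.
  rewrite (bigD1 i)//= [leRHS](bigD1 i)//= mxE eqxx.
  under [X in _ <= _ + X]eq_bigr => l /negbTE li do rewrite mxE li.
  by rewrite lerD2r.
have boxu n (p : 'rV[R]_n) i y : box n p -> 0 <= y <= S ->
    box n (\row_i' (if i' == i then y else p ord0 i')).
  by move=> bp yS i'; rewrite /= mxE; case: ifP => // _; exact: bp.
have box_neq0 : box m `*` box k !=set0 by exists (const_mx 0, const_mx 0).
have [[p q]] := compact_EVT_min box_neq0 cbox (continuous_subspaceT cF).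
move=> /set_mem[/= bp bq] minF.
have p0S i : 0 <= p ord0 i <= S by have := bp i; rewrite /= in_itv.
have q0S j : 0 <= q ord0 j <= S by have := bq j; rewrite /= in_itv.
exists (p ord0), (q ord0); split.
- by move=> i; case/andP: (p0S i).
- by move=> j; case/andP: (q0S j).
- move=> i.
  have -> : \sum_j pospart (s i j - p ord0 i - q ord0 j) / e =
      \sum_j pospart (s i j - q ord0 j - p ord0 i) / e.
    by apply: eq_bigr => j _; rewrite addrAC.
  apply: (@pospart_penalty_min R k _ (mu i) e S) => //.
    by move=> j; have := sS i j; have := q0S j; lra.
  move=> y yS; apply: (sep _ (fun i y => mu i * y +
    \sum_j pospart (s i j - q ord0 j - y) ^+ 2 / (2 * e))).
  have := minF (_, q) (mem_set (conj (boxu _ _ i _ bp yS) bq)).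
  rewrite /F/= !big_split/= [leLHS]addrAC [leRHS]addrAC lerD2r.
  by under [X in _ + X <= _ -> _]eq_bigr do under eq_bigr do rewrite /pen/= addrAC;
    under [X in _ <= _ + X -> _]eq_bigr do under eq_bigr do rewrite /pen/= addrAC.
- move=> j.
  apply: (@pospart_penalty_min R m _ (nu j) e S) => //.
    by move=> i; have := sS i j; have := p0S i; lra.
  move=> y yS; apply: (sep _ (fun j y => nu j * y +
    \sum_i pospart (s i j - p ord0 i - y) ^+ 2 / (2 * e))).
  have := minF (p, _) (mem_set (conj bp (boxu _ _ j _ bq yS))).
  rewrite /F/= !big_split/= -!addrA lerD2l.
  by rewrite [X in _ + X <= _]exchange_big/= [X in _ <= _ + X]exchange_big.
Qed.

(** * Borel measures *)

Section borel.
Context (R : realType) (T : normedModType R).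

Lemma borel_open (A : set (borelType T)) : open (A : set T) -> measurable A.
Proof. exact: sub_sigma_algebra. Qed.

Lemma borel_closed (A : set (borelType T)) : closed (A : set T) -> measurable A.
Proof. by rewrite -openC -[A]setCK => /borel_open /measurableC; rewrite !setCK. Qed.

Lemma borel_compact (A : set (borelType T)) : compact (A : set T) -> measurable A.
Proof.
by move=> cA; apply: borel_closed; apply: compact_closed => //;
  exact: norm_hausdorff.
Qed.

Lemma borel_continuous (T' : normedModType R) (f : T -> T') : continuous f ->
  measurable_fun setT (f : borelType T -> borelType T').
Proof.
move=> cf.
apply: (@measurability _ _ (borelType T) (borelType T') setT f (@open T')) => //.
move=> _ [G oG <-]; rewrite setTI; apply: borel_open.
exact: (proj1 (continuousP _) cf).
Qed.

Lemma borel_preimage (T' : normedModType R) (f : T -> T') (B : set (borelType T')) :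
  continuous f -> measurable B -> measurable (f @^-1` B : set (borelType T)).
Proof.
by move=> cf mB; rewrite -[X in measurable X]setTI; exact: (borel_continuous cf).
Qed.

(* Closed sets are decreasing intersections of open ones, so the inequality
   reverses on closed sets by passing to complements. *)
Lemma closed_measure_eq (m1 m2 : {measure set (borelType T) -> \bar R}) :
  (m2 setT <= m1 setT)%E -> (m1 setT < +oo)%E ->
  (forall A : set (borelType T), closed (A : set T) -> (m1 A <= m2 A)%E) ->
  forall A : set (borelType T), measurable A -> m1 A = m2 A.
Proof.
move=> m21 m1oo m12.
have mT : m1 setT = m2 setT by apply/eqP; rewrite eq_le m21 m12//; exact: closedT.
have compl (m : {measure set (borelType T) -> \bar R}) (A : set (borelType T)) :
    (m setT < +oo)%E -> measurable A -> m A = (m setT - m (~` A))%E.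
  move=> moo mA; have mCA : measurable (~` A) by exact: measurableC.
  by rewrite -[in LHS](setCK A) -setTD measureD// setTI.
have m2oo : (m2 setT < +oo)%E by rewrite -mT.
have open_le (A : set (borelType T)) : open (A : set T) -> (m2 A <= m1 A)%E.
  move=> oA; have mA := borel_open oA.
  rewrite (compl m1)// (compl m2)// mT leeB//; apply: m12; exact: open_closedC.
have closed_eq (A : set (borelType T)) : closed (A : set T) -> m1 A = m2 A.
  move=> cA; apply/eqP; rewrite eq_le m12//=.
  pose G k : set (borelType T) := \bigcup_(t in A) ball (t : T) k.+1%:R^-1.
  have oG k : open (G k : set T) by apply: bigcup_open => t _; exact: ball_open.
  have GA : \bigcap_k G k = A.
    apply/seteqP; split=> [t Gt|t At k _]; last first.
      by exists t => //; apply: ballxx; rewrite invr_gt0.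
    apply: cA => B /nbhs_ballP[e /= e0 eB].
    have [k ke] := ltr_add_invr e0; rewrite add0r in ke.
    have [s As st] := Gt k I; exists s; split=> //; apply: eB.
    by apply: ball_sym; apply: le_ball st; exact: ltW.
  have niG : nonincreasing_seq G.
    move=> i j ij; apply/subsetPset => t [s As st]; exists s => //.
    by apply: le_ball st; rewrite lef_pV2 ?posrE// ler_nat.
  have cvG (m : {measure set (borelType T) -> \bar R}) :
      (m setT < +oo)%E -> m (G k) @[k --> \oo] --> m A.
    move=> moo; rewrite -GA; apply: nonincreasing_cvg_mu => //.
    - by rewrite (le_lt_trans _ moo)// le_measure ?inE//; exact: borel_open.
    - by move=> k; exact: borel_open.
    - by rewrite GA; exact: borel_closed.
  apply: (lee_cvg_to (cvG m2 m2oo) (cvG m1 m1oo)) => //.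
  by apply: nearW => k; exact: open_le.
move=> A mA.
apply: (@measure_unique _ R (borelType T) (@open T) (fun=> setT) _ _ _ _ m1 m2) => //.
- exact: openI.
- by move=> _; exact: openT.
- by apply/seteqP; split=> // t _; exists 0%N.
move=> B oB; have mB := borel_open oB.
by rewrite (compl m1)// (compl m2)// mT closed_eq//; exact: open_closedC.
Qed.

(** A finite subcover by balls of radius [d], made disjoint by removing from each ball the earlier
    ones. A centre lies in [X] but not necessarily in its own cell, which may be empty. *)
Lemma compact_partition (X : set T) (d : R) : compact X -> 0 < d ->
  exists m (c : 'I_m -> T) (P : 'I_m -> set (borelType T)),
    [/\ forall i, X (c i), forall i, measurable (P i), trivIset setT P,
        \big[setU/set0]_i P i = X & forall i x, P i x -> ball (c i) d x].
Proof.
move=> cX d0; have := cX; rewrite compact_cover => /(_ T X (fun t => ball t d)).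
case=> [t _|t Xt|D DX XD].
- exact: ball_open.
- by exists t => //; exact: ballxx.
pose s : seq T := finmap.enum_fset D.
pose B (n : nat) : set (borelType T) :=
  if (n < size s)%N then X `&` ball (nth 0 s n) d else set0.
have mB n : measurable (B n).
  rewrite /B; case: ifP => // _; apply: measurableI; first exact: borel_compact.
  by apply: borel_open; exact: ball_open.
exists (size s), (fun i => nth 0 s i), (fun i => seqDU B i); split.
- by move=> i; have := DX (nth 0 s i); rewrite inE; apply; apply: mem_nth.
- by move=> i; exact: seqDU_measurable.
- apply/trivIsetP => i j _ _ ij.
  by have /trivIsetP := trivIset_seqDU B; apply.
- rewrite -bigsetU_seqDU -(bigcup_mkord _ B); apply/seteqP; split=> t.
    by move=> [n /= ns]; rewrite /B ns => -[].
  move=> Xt; have [c Dc ct] := XD t Xt.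
  have cs : (index c s < size s)%N by rewrite index_mem.
  by exists (index c s) => //; rewrite /B cs; split=> //; rewrite nth_index.
- by move=> i x [+ _]; rewrite /B ltn_ord => -[].
Qed.

(* As [d] tends to 0, these upper bounds and the equality of total masses determine
   [mu], see [marginal_limit]. *)
Lemma discretization (X : set T) (mu : {finite_measure set (borelType T) -> \bar R})
    (d : R) : compact X -> 0 < d -> mu (~` X : set (borelType T)) = 0%E ->
  exists m (c : 'I_m -> T) (w : 'I_m -> R),
    [/\ forall i, X (c i), forall i, 0 <= w i, (\sum_i w i)%:E = mu setT &
        forall A : set (borelType T), measurable A ->
          (mu A <= (\sum_i w i *
            (\1_[set t : T | exists2 t', A t' & ball t d t'] (c i)))%:E)%E].
Proof.
move=> cX d0 muX; have [m [c [P [Xc mP tP PX Pc]]]] := compact_partition cX d0.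
have mX : measurable (X : set (borelType T)) by exact: borel_compact.
have fP i : mu (P i) \is a fin_num by exact: fin_num_measure.
have muI (A : set (borelType T)) : measurable A -> mu A = mu (A `&` X).
  move=> mA; apply/eqP; rewrite eq_le; apply/andP; split; last first.
    by apply: le_measure; rewrite ?inE//; exact: measurableI.
  rewrite -[in leLHS](setUIDK A X) (le_trans (measureU2 _ _ _))//.
  - exact: measurableI.
  - exact: measurableD.
  rewrite -[leRHS]adde0 leeD2l// -[leRHS]muX le_measure ?inE//.
  - exact: measurableD.
  - exact: measurableC.
exists m, c, (fun i => fine (mu (P i))); split => //.
- by move=> i; exact: fine_ge0.
- rewrite muI// setTI -PX measure_semi_additive_ord//.
    by rewrite -sumEFin; apply: eq_bigr => i _; rewrite fineK.
  by apply: bigsetU_measurable.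
- move=> A mA; rewrite muI// -PX big_distrr/=.
  rewrite measure_bigsetU_ord//; last 2 first.
  - by move=> i; exact: measurableI.
  - exact: trivIset_setIl.
  rewrite -sumEFin; apply: lee_sum => i _; rewrite indicE.
  (* A cell that meets [A] has its centre within [d] of [A], so its whole weight is counted on the
     right. *)
  have [t'P|nP] := pselect (exists2 t', A t' & ball (c i) d t').
    rewrite mem_set// mulr1 fineK//.
    by apply: le_measure; rewrite ?inE//; exact: measurableI.
  rewrite memNset// mulr0 (_ : _ `&` _ = set0) ?measure0//.
  by apply/seteqP; split=> // t [At Pt]; apply: nP; exists t => //; exact: Pc Pt.
Qed.

End borel.

(** * Approximate equilibria *)

Lemma indicU_disjoint (R : pzRingType) (T : Type) (A B : set T) (t : T) :
  A `&` B = set0 -> \1_(A `|` B) t = \1_A t + \1_B t :> R.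
Proof.
move=> AB; rewrite !indicE in_setU.
have [At|_] := boolP (t \in A); last by rewrite add0r.
rewrite (_ : t \in B = false) ?addr0//; apply/negbTE/negP => Bt.
have : (A `&` B) t by split; exact/set_mem.
by rewrite AB.
Qed.

Lemma indic0 (R : pzRingType) (T : Type) (A : set T) (t : T) :
  ~ A t -> \1_A t = 0 :> R.
Proof. by move=> At; rewrite indicE memNset. Qed.

Section approximate_equilibrium.
Context (R : realType) (TX TY : normedModType R) (TZ : Type).
Variables (X : set TX) (Y : set TY) (Z0 : set TZ) (zd zs : TZ).
Variables (F : TX -> TZ -> R) (G : TY -> TZ -> R) (a b : TZ -> R).
Variables (mu : {finite_measure set (borelType TX) -> \bar R})
  (nu : {finite_measure set (borelType TY) -> \bar R}).
Let Z := Z0 `|` [set zd] `|` [set zs].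
Let W := (TX * (TY * TZ))%type.
Hypotheses (cX : compact X) (cY : compact Y) (X0 : X !=set0) (Y0 : Y !=set0).
Hypotheses (zds : zd <> zs) (Z0d : ~ Z0 zd) (Z0s : ~ Z0 zs).
Hypotheses (Fd : forall x, F x zd = 0) (Fs : forall x, F x zs = -1).
Hypotheses (Gs : forall y, G y zs = 0) (Gd : forall y, G y zd = 1).
Hypotheses (aG : forall y z, Y y -> Z0 z -> a z <= G y z)
  (Fb : forall x z, X x -> Z0 z -> F x z <= b z).
Hypothesis argmaxFG : forall x y, X x -> Y y -> exists2 z, Z z &
  forall z', Z z' -> F x z' - G y z' <= F x z - G y z.
Hypotheses (muX : mu (~` X : set (borelType TX)) = 0%E)
  (nuY : nu (~` Y : set (borelType TY)) = 0%E).

(** [th] is the discrete trade measure, [S] a set carrying it and [P] the price. The last clause on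
    [P] bounds its oscillation by those of [a] and [F] alone, not by [e]; this is the source of
    equicontinuity. The marginals are given as upper bounds on thickened sets, which suffice in the
    limit. *)
Lemma approximate_equilibrium (e : R) : 0 < e ->
  exists (th : set W -> R) (P : TZ -> R) (S : set W),
  [/\ (forall A, 0 <= th A) /\
        (forall A B, A `&` B = set0 -> th (A `|` B) = th A + th B),
      th (~` S) = 0 /\ forall w, S w -> [/\ X w.1, Y w.2.1, Z w.2.2,
        (w.2.2 <> zs -> forall z, Z z ->
          F w.1 z - P z <= F w.1 w.2.2 - P w.2.2 + e) &
        (w.2.2 <> zd -> forall z, Z z ->
          G w.2.1 w.2.2 - P w.2.2 <= G w.2.1 z - P z + e)],
      [/\ P zd = 0, P zs = 0, forall z, Z0 z -> a z <= P z <= Num.max (a z) (b z) &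
        forall z z' d, Z0 z -> Z0 z' -> `|a z - a z'| <= d ->
          (forall x, X x -> `|F x z - F x z'| <= d) -> `|P z - P z'| <= d],
      (th [set w | w.2.2 <> zs])%:E = mu setT /\
        forall A : set (borelType TX), measurable A -> (mu A <=
          (th [set w | w.2.2 <> zs /\ exists2 t, A t & ball w.1 e t])%:E)%E &
      (th [set w | w.2.2 <> zd])%:E = nu setT /\
        forall A : set (borelType TY), measurable A -> (nu A <=
          (th [set w | w.2.2 <> zd /\ exists2 t, A t & ball w.2.1 e t])%:E)%E].
Proof.
move=> e0.
have [m [x [p [Xx p0 psum pA]]]] := discretization cX e0 muX.
have [k [y [q [Yy q0 qsum qA]]]] := discretization cY e0 nuY.
have [x0 Xx0] := X0; have [y0 Yy0] := Y0.
pose M := \sum_i p i.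
have M0 : 0 <= M by exact: sumr_ge0.
have [zz zzP] := choice (fun ij : 'I_m * 'I_k =>
  let: ex_intro2 z Zz zmax := argmaxFG (Xx ij.1) (Yy ij.2) in
  ex_intro (fun z => Z z /\ forall z', Z z' ->
     F (x ij.1) z' - G (y ij.2) z' <= F (x ij.1) z - G (y ij.2) z) z (conj Zz zmax)).
pose s i j := F (x i) (zz (i, j)) - G (y j) (zz (i, j)).
(* The matching is bounded by the total mass [M], so the violation of dual feasibility, which is the
   matching times this parameter, is at most [e]. *)
have e'0 : 0 < e / (M + 1) by rewrite divr_gt0//; lra.
have [phi [psi [phi0 psi0 gp gq]]] := regularized_assignment s e'0 p0 q0.
pose g i j := pospart (s i j - phi i - psi j) / (e / (M + 1)).
have g0 i j : 0 <= g i j by rewrite divr_ge0 ?pospart_ge0// ltW.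
have gM i j : g i j <= M.
  apply: (@le_trans _ _ (\sum_j g i j)).
    by rewrite (bigD1 j)//= lerDl sumr_ge0.
  rewrite (le_trans (gp i).1)// /M (bigD1 i)//= lerDl sumr_ge0//.
have slack i j : s i j <= phi i + psi j + e.
  have : pospart (s i j - phi i - psi j) <= e.
    have -> : pospart (s i j - phi i - psi j) = g i j * (e / (M + 1)).
      by rewrite /g divfK// gt_eqF.
    rewrite mulrCA -[leRHS]mulr1 ler_pM2l// ler_pdivrMr; last by lra.
    by have := gM i j; lra.
  by have := ge_pospart (s i j - phi i - psi j); lra.
have gpos i j : 0 < g i j -> phi i + psi j <= s i j.
  rewrite pmulr_lgt0 ?invr_gt0// /pospart lt_max ltxx/=; lra.
(* Both dummy goods have surplus [-1], whereas a pair that trades has surplus at least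
   [phi i + psi j >= 0]. *)
have gZ0 i j : 0 < g i j -> Z0 (zz (i, j)).
  move=> /gpos; have := (zzP (i, j)).1; rewrite /s => -[[//|/= ->]|/= ->].
    by rewrite Fd Gd; have := phi0 i; have := psi0 j; lra.
  by rewrite Fs Gs; have := phi0 i; have := psi0 j; lra.
(* Residual masses of unmatched agents. Complementary slackness gives these agents utility 0, which
   is what their dummy good pays them. *)
pose rp i := p i - \sum_j g i j; pose rq j := q j - \sum_i g i j.
have rp0 i : 0 <= rp i by rewrite subr_ge0; exact: (gp i).1.
have rq0 j : 0 <= rq j by rewrite subr_ge0; exact: (gq j).1.
have rp_phi i : 0 < rp i -> phi i = 0.
  move=> rpi; apply/eqP; rewrite eq_le phi0 andbT leNgt; apply/negP.
  by move=> /(gp i).2; rewrite /rp in rpi *; lra.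
have rq_psi j : 0 < rq j -> psi j = 0.
  move=> rqj; apply/eqP; rewrite eq_le psi0 andbT leNgt; apply/negP.
  by move=> /(gq j).2; rewrite /rq in rqj *; lra.
pose th (A : set W) : R := \sum_i \sum_j g i j * \1_A (x i, (y j, zz (i, j)))
  + \sum_i rp i * \1_A (x i, (y0, zd)) + \sum_j rq j * \1_A (x0, (y j, zs)).
(* The lowest price, not below [a z], at which no buyer gains more than [phi i] from [z]; being
   lowest is what bounds the sellers' gains in [sP]. *)
pose P z : R := if `[< Z0 z >] then \big[Num.max/a z]_i (F (x i) z - phi i) else 0.
have PZ0 z : Z0 z -> P z = \big[Num.max/a z]_i (F (x i) z - phi i).
  by move=> Z0z; rewrite /P asboolT.
have Pd : P zd = 0 by rewrite /P asboolF.
have Ps : P zs = 0 by rewrite /P asboolF.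
have aP z : Z0 z -> a z <= P z by move=> Z0z; rewrite PZ0// bigmax_ge_id.
have FP i z : Z0 z -> F (x i) z - phi i <= P z.
  by move=> Z0z; rewrite PZ0//; apply: le_bigmax.
have Ple z c : Z0 z -> a z <= c -> (forall i, F (x i) z - phi i <= c) -> P z <= c.
  by move=> Z0z ac Fc; rewrite PZ0//; apply/bigmax_leP; split.
have dP i z : Z z -> F (x i) z - P z <= phi i.
  move=> [[Z0z|/= ->]|/= ->]; first by have := FP i z Z0z; lra.
    by rewrite Fd Pd; have := phi0 i; lra.
  by rewrite Fs Ps; have := phi0 i; lra.
(* [P z] is either [a z], hence at most the cost of the seller, or [F (x i) z - phi i] for some [i];
   in the latter case the gain of the seller is at most [s i j - phi i], by maximality of the
   surplus. *)
have sP j z : Z z -> P z - G (y j) z <= psi j + e.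
  move=> Zz; case: (Zz) => [[Z0z|/= ->]|/= ->].
  - rewrite lerBlDl; apply: Ple => //.
      by rewrite (le_trans (aG (Yy j) Z0z))// lerDl; have := psi0 j; lra.
    move=> i; have := (zzP (i, j)).2 z Zz; have := slack i j; rewrite /s/=; lra.
  - by rewrite Gd Pd; have := psi0 j; lra.
  - by rewrite Gs Ps; have := psi0 j; lra.
pose S : set W := [set w | (exists i j, 0 < g i j /\ w = (x i, (y j, zz (i, j))))
  \/ (exists i, 0 < rp i /\ w = (x i, (y0, zd)))
  \/ (exists j, 0 < rq j /\ w = (x0, (y j, zs)))].
(* Only residual sellers sit at [zs]. Elsewhere, buyer [i] carries its matched mass plus [rp i],
   that is [p i]. *)
have thX (A : set TX) : th [set w | w.2.2 <> zs /\ A w.1] = \sum_i p i * \1_A (x i).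
  rewrite /th [X in _ + X]big1 ?addr0; last first.
    by move=> j _; rewrite indic0 ?mulr0//= => -[].
  rewrite -big_split/=; apply: eq_bigr => i _.
  have -> : \1_[set w : W | w.2.2 <> zs /\ A w.1] (x i, (y0, zd)) = \1_A (x i) :> R.
    by rewrite !indicE; congr (_%:R); congr nat_of_bool; apply/idP/idP;
      rewrite !inE/= => // -[].
  rewrite (_ : \sum_j _ = \sum_j g i j * \1_A (x i)); last first.
    apply: eq_bigr => j _; have := g0 i j; rewrite le_eqVlt => /predU1P[<-|gij].
      by rewrite !mul0r.
    congr (_ * _); rewrite !indicE; congr (_%:R); congr nat_of_bool.
    apply/idP/idP; rewrite !inE/=; first by case.
    by move=> Ax; split=> // zzs; have := gZ0 _ _ gij; rewrite zzs.
  by rewrite -mulr_suml -mulrDl /rp addrC subrK.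
have thY (A : set TY) : th [set w | w.2.2 <> zd /\ A w.2.1] = \sum_j q j * \1_A (y j).
  rewrite /th [X in _ + X + _]big1 ?addr0; last first.
    by move=> j _; rewrite indic0 ?mulr0//= => -[].
  rewrite exchange_big -big_split/=; apply: eq_bigr => j _.
  have -> : \1_[set w : W | w.2.2 <> zd /\ A w.2.1] (x0, (y j, zs)) = \1_A (y j) :> R.
    rewrite !indicE; congr (_%:R); congr nat_of_bool; apply/idP/idP;
      rewrite !inE/=; first by case.
    by move=> Ay; split=> // /esym.
  rewrite (_ : \sum_i _ = \sum_i g i j * \1_A (y j)); last first.
    apply: eq_bigr => i _; have := g0 i j; rewrite le_eqVlt => /predU1P[<-|gij].
      by rewrite !mul0r.
    congr (_ * _); rewrite !indicE; congr (_%:R); congr nat_of_bool.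
    apply/idP/idP; rewrite !inE/=; first by case.
    by move=> Ax; split=> // zzd; have := gZ0 _ _ gij; rewrite zzd.
  by rewrite -mulr_suml -mulrDl /rq addrC subrK.
exists th, P, S; split.
- split=> [A|A B AB].
    by rewrite /th !addr_ge0// sumr_ge0// => *; rewrite ?sumr_ge0// => *;
      rewrite mulr_ge0// indicE.
  rewrite /th; under eq_bigr do under eq_bigr do rewrite indicU_disjoint// mulrDr.
  under eq_bigr do rewrite big_split.
  under [X in _ + X + _]eq_bigr do rewrite indicU_disjoint// mulrDr.
  under [X in _ + X]eq_bigr do rewrite indicU_disjoint// mulrDr.
  rewrite !big_split/=; lra.
- split.
    rewrite /th !big1 ?addr0// => [j _|i _|i _].
    + have := rq0 j; rewrite le_eqVlt => /predU1P[<-|rj]; first by rewrite mul0r.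
      by rewrite indic0 ?mulr0//; apply; right; right; exists j.
    + have := rp0 i; rewrite le_eqVlt => /predU1P[<-|ri]; first by rewrite mul0r.
      by rewrite indic0 ?mulr0//; apply; right; left; exists i.
    + rewrite big1// => j _.
      have := g0 i j; rewrite le_eqVlt => /predU1P[<-|gij]; first by rewrite mul0r.
      by rewrite indic0 ?mulr0//; apply; left; exists i, j.
  move=> w [[i [j [gij ->]]]|[[i [ri ->]]|[j [rj ->]]]]/=; split=> //.
  + exact: (zzP (i, j)).1.
  (* For a trading pair, [F (x i) z - P z <= phi i <= s i j - psi j], and [sP] at the traded good
     bounds the last term by the buyer's net utility there plus [e]. The next case exchanges the two
     roles. *)
  + move=> _ z Zz; have := dP i z Zz; have := gpos _ _ gij.
    have := sP j _ (zzP (i, j)).1; rewrite /s; lra.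
  + move=> _ z Zz; have := sP j z Zz; have := gpos _ _ gij.
    have := dP i _ (zzP (i, j)).1; rewrite /s; lra.
  + by left; right.
  + by move=> _ z Zz; have := dP i z Zz; rewrite Fd Pd (rp_phi _ ri); lra.
  + by right.
  + by move=> _ z Zz; have := sP j z Zz; rewrite Gs Ps (rq_psi _ rj); lra.
- split=> // [z Z0z|z z' d Z0z Z0z' azz' Fzz'].
    rewrite aP//=; apply: Ple => //; first by rewrite le_max lexx.
    move=> i; rewrite le_max; apply/orP; right.
    by have := Fb (Xx i) Z0z; have := phi0 i; lra.
  have half z1 z2 : Z0 z1 -> Z0 z2 -> `|a z1 - a z2| <= d ->
      (forall x, X x -> `|F x z1 - F x z2| <= d) -> P z1 <= P z2 + d.
    move=> Z1 Z2 a12 F12; apply: Ple => //.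
      by have := aP _ Z2; have := ler_norm (a z1 - a z2); lra.
    move=> i; have := FP i _ Z2; have := F12 _ (Xx i).
    by have := ler_norm (F (x i) z1 - F (x i) z2); lra.
  rewrite ler_norml; apply/andP; split.
    have : P z' <= P z + d; last by lra.
    by apply: half => //; [rewrite distrC|move=> t Xt; rewrite distrC; exact: Fzz'].
  by have := half z z' Z0z Z0z' azz' Fzz'; lra.
- split; last by move=> A mA; have := pA _ mA; rewrite -thX.
  rewrite -psum (_ : [set w : W | _] = [set w | w.2.2 <> zs /\ setT w.1]).
    by rewrite thX; congr EFin; apply: eq_bigr => i _; rewrite indicT mulr1.
  by apply/seteqP; split=> [w|w []].
- split; last by move=> A mA; have := qA _ mA; rewrite -thY.
  rewrite -qsum (_ : [set w : W | _] = [set w | w.2.2 <> zd /\ setT w.2.1]).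
    by rewrite thY; congr EFin; apply: eq_bigr => i _; rewrite indicT mulr1.
  by apply/seteqP; split=> [w|w []].
Qed.

End approximate_equilibrium.

(** * Demand and supply *)

Lemma within_continuous_cvg (S : Type) (D : set_system S) (FD : Filter D)
    (T1 T2 : topologicalType) (A : set T1) (f : T1 -> T2) (w : S -> T1) (t : T1) :
  {within A, continuous f} -> A t -> (\forall s \near D, A (w s)) ->
  w @ D --> t -> f (w s) @[s --> D] --> f t.
Proof.
move=> /subspace_continuousP cf At Aw wt.
apply: cvg_trans (cf t At) => B; rewrite /within/= => Bt.
have := wt _ Bt; rewrite /= => H.
by apply: filterS (filterI Aw H) => s [As]; apply.
Qed.

Lemma cvg_to_pair (S : Type) (D : set_system S) (FD : Filter D)
    (T1 T2 : topologicalType) (f : S -> T1) (g : S -> T2) (a : T1) (b : T2) :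
  f @ D --> a -> g @ D --> b -> (f s, g s) @[s --> D] --> (a, b).
Proof.
move=> fa gb B [[A1 A2] [/= n1 n2] AB].
have H1 : \forall s \near D, A1 (f s) by exact: fa.
have H2 : \forall s \near D, A2 (g s) by exact: gb.
by apply: filterS (filterI H1 H2) => s [? ?]; apply: AB.
Qed.

Lemma within_continuous_ge_compact (R : realType) (T : topologicalType) (K : set T)
    (f : T -> R) (c : R) : compact K -> {within K, continuous f} ->
  compact [set t | K t /\ c <= f t].
Proof.
move=> cK cf; rewrite compact_ultra => U UU Uc.
have UK : U K by apply: filterS Uc => t [].
have [t [Kt Ut]] : K `&` [set t | U --> t] !=set0.
  by move: cK; rewrite compact_ultra; apply.
exists t; split=> //; split=> //.
have ft : f t' @[t' --> U] --> f t.
  exact: (@within_continuous_cvg _ _ _ _ _ _ _ id t cf).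
have -> : (c <= f t) = (c <= lim (f t' @[t' --> U])).
  by congr (_ <= _); apply/esym/cvg_lim => //; exact: norm_hausdorff.
by apply: limr_ge; [exact: cvgP ft|apply: filterS Uc => t' []].
Qed.

Lemma within_continuous_bounded (R : realType) (T : topologicalType) (K : set T)
    (f : T -> R) : compact K -> {within K, continuous f} ->
  exists M, forall t, K t -> `|f t| <= M.
Proof.
move=> cK cf; have [K0|/nonemptyPn K0] := pselect (K !=set0); last first.
  by exists 0 => t Kt; rewrite K0 in Kt.
have [a _ amax] := compact_EVT_max K0 cK cf.
have [b _ bmin] := compact_EVT_min K0 cK cf.
exists (`|f a| + `|f b|) => t Kt.
have := amax t (mem_set Kt); have := bmin t (mem_set Kt).
have := ler_norm (f a); have := ler_norm (- f b); rewrite normrN => *.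
by rewrite ler_norml; have := normr_ge0 (f a); have := normr_ge0 (f b); lra.
Qed.

(** * The dummy goods as isolated points of the space of goods *)

Section isolated_points.
Context (R : realType) (d3 : nat) (Z0 : set 'rV[R]_d3) (zd zs : 'rV[R]_d3).
Hypotheses (cZ0 : compact Z0) (zds : zd <> zs) (Z0d : ~ Z0 zd) (Z0s : ~ Z0 zs).
Local Notation Z := (Zset Z0 zd zs).

Lemma ZsetC : Zset Z0 zs zd = Z.
Proof. by rewrite /Zset setUAC. Qed.

Lemma Zset_compact : compact Z.
Proof. by apply: compactU; [apply: compactU => //|]; exact: compact_set1. Qed.

Lemma near_notin_compact (A : set 'rV[R]_d3) z : compact A -> ~ A z ->
  \forall z' \near z, ~ A z'.
Proof.
move=> /(compact_closed (@norm_hausdorff _ _)) clA nAz.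
by apply: open_nbhs_nbhs; split=> //; exact: closed_openC.
Qed.

Lemma near_zd : \forall z \near zd, Z z -> z = zd.
Proof.
have nA : ~ (Z0 `|` [set zs]) zd by case=> // /esym; exact/nesym.
have cA : compact (Z0 `|` [set zs]) by apply: compactU => //; exact: compact_set1.
apply: filterS (near_notin_compact cA nA) => z nz [[Zz|//]|zz]; exfalso; apply: nz.
  by left.
by right.
Qed.

Lemma near_Z0 z : Z0 z -> \forall z' \near z, Z z' -> Z0 z'.
Proof.
move=> Zz; have nA : ~ ([set zd] `|` [set zs]) z by case=> /= ze; rewrite ze in Zz.
have cA : compact ([set zd] `|` [set zs]) by apply: compactU; exact: compact_set1.
apply: filterS (near_notin_compact cA nA) => z' nz [[//|zz]|zz]; exfalso; apply: nz.
  by left.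
by right.
Qed.

End isolated_points.

(** * Continuity of the extended payoff, indirect utility and the graph of demand *)

Section demand.
Context (R : realType) (d1 d3 : nat) (X : set 'rV[R]_d1) (Z0 : set 'rV[R]_d3)
  (zd zs : 'rV[R]_d3) (u : 'rV[R]_d1 -> 'rV[R]_d3 -> R).
Hypotheses (cX : compact X) (X0 : X !=set0).
Hypotheses (cZ0 : compact Z0) (zds : zd <> zs) (Z0d : ~ Z0 zd) (Z0s : ~ Z0 zs).
Hypothesis cu : forall w : 'rV[R]_d1 * 'rV[R]_d3, X w.1 -> Z0 w.2 ->
  {for w, continuous (fun w : 'rV[R]_d1 * 'rV[R]_d3 => u w.1 w.2)}.
Local Notation Z := (Zset Z0 zd zs).
Local Notation F := (uext zd zs u).

Let cZ : compact Z. Proof. exact: Zset_compact. Qed.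
Let Zd : Z zd. Proof. by left; right. Qed.
Let Zs : Z zs. Proof. by right. Qed.

Lemma uext_d x : F x zd = 0. Proof. by rewrite /uext eqxx. Qed.

Lemma uext_s x : F x zs = -1.
Proof. by rewrite /uext eqxx ifF//; apply/eqP/nesym. Qed.

Lemma uext_Z0 x z : Z0 z -> F x z = u x z.
Proof.
move=> Zz; rewrite /uext !ifF//; apply/eqP => ze; rewrite ze in Zz.
  exact: Z0s Zz.
exact: Z0d Zz.
Qed.

(** Near a dummy good, a point of [Z] equals that good, where the payoff does not depend on [x];
    near a point of [Z0], the points of [Z] lie in [Z0] and the extension is [u]. *)
Lemma uext_continuous :
  {within X `*` Z, continuous (fun w : 'rV[R]_d1 * 'rV[R]_d3 => F w.1 w.2)}.
Proof.
apply/subspace_continuousP; rewrite /from_subspace => -[x z] [/= Xx Zz].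
have cst (z0 : 'rV[R]_d3) : (\forall z \near z0, Z z -> z = z0) ->
    (forall x, F x z0 = F point z0) ->
    (fun w : 'rV[R]_d1 * 'rV[R]_d3 => F w.1 w.2) @ within (X `*` Z) (nbhs (x, z0))
      --> F x z0.
  move=> nz0 Fz0; rewrite Fz0; apply: cvg_near_cst; rewrite near_withinE.
  have : \forall w \near ((x, z0) : 'rV[R]_d1 * 'rV[R]_d3), Z w.2 -> w.2 = z0.
    by exists (setT, [set z | Z z -> z = z0]) => [|[? ?] [] //]; split=> //;
      exact: filterT.
  by apply: filterS => -[x' z'] /= zz [_ /= /zz ->]; exact: Fz0.
case: (Zz) => [[Z0z|/= ->]|/= ->].
- rewrite uext_Z0//; have H : u w.1 w.2 @[w --> within (X `*` Z) (nbhs (x, z))] --> u x z.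
    apply: cvg_trans (cu (w := (x, z)) Xx Z0z); apply: cvg_app.
    exact: cvg_within.
  apply: cvg_trans H; apply: near_eq_cvg; rewrite near_withinE.
  have : \forall w \near ((x, z) : 'rV[R]_d1 * 'rV[R]_d3), Z w.2 -> Z0 w.2.
    exists (setT, [set z' | Z z' -> Z0 z']) => [|[? ?] [] //].
    by split; [exact: filterT|exact: near_Z0].
  by apply: filterS => -[x' z'] /= zz [_ /= /zz Z0z']; rewrite /= uext_Z0.
- by apply: cst => [|?]; [exact: near_zd|rewrite !uext_d].
- apply: cst => [|?]; last by rewrite !uext_s.
  by rewrite -ZsetC; apply: near_zd => //; exact/nesym.
Qed.

(** Compactness of [X] makes joint continuity uniform in [x]: near [x], both [F x' z'] and [F x' z]
    are compared with [F x z], each at cost [e / 2]. *)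
Lemma uext_near_uniform z e : Z z -> 0 < e ->
  \forall z' \near within Z (nbhs z), forall x, X x -> `|F x z' - F x z| <= e.
Proof.
move=> Zz e0.
have := cX; rewrite compact_near_coveringP => /near_covering_withinP cov.
have := cov _ (within Z (nbhs z)) (fun z' x => `|F x z' - F x z| <= e) _; apply.
move=> x Xx; have e20 : 0 < e / 2 by rewrite divr_gt0.
have : \forall w \near within (X `*` Z) (nbhs (x, z)), `|F x z - F w.1 w.2| < e / 2.
  apply: cvgr_dist_lt e20.
  exact: (proj1 (subspace_continuousP _ _) uext_continuous (x, z) (conj Xx Zz)).
rewrite near_withinE => -[[A B] /= [nA nB] AB].
exists (A, [set z' | B z' /\ Z z']) => /=.
  split=> //; rewrite /within/=; apply: filterS nB => z' Bz' Zz' //.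
move=> [x' z'] /= [Ax' [Bz' Zz']] Xx'.
have /= H1 := AB (x', z') (conj Ax' Bz') (conj Xx' Zz').
have /= H2 := AB (x', z) (conj Ax' (nbhs_singleton nB)) (conj Xx' Zz).
rewrite (_ : F x' z' - F x' z = (F x z - F x' z) - (F x z - F x' z')); last by lra.
by rewrite (le_trans (ler_normB _ _))//; lra.
Qed.

Lemma uext_continuous_l z : Z z -> {within X, continuous (F^~ z)}.
Proof.
move=> Zz; apply/subspace_continuousP; rewrite /from_subspace => x Xx.
apply: (@within_continuous_cvg _ _ _ _ _ _ _ (fun x => (x, z)) (x, z)
  uext_continuous) => //.
  by rewrite near_withinE; apply: nearW => x' Xx'.
move=> B [[A1 A2] [/= n1 n2] AB]; apply: filterS n1 => x' A1x' _.
by apply: AB; split=> //; exact: nbhs_singleton.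
Qed.

Lemma uext_continuous_r x : X x -> {within Z, continuous (F x)}.
Proof.
move=> Xx; apply/subspace_continuousP; rewrite /from_subspace => z Zz.
apply: (@within_continuous_cvg _ _ _ _ _ _ _ (fun z => (x, z)) (x, z)
  uext_continuous) => //.
  by rewrite near_withinE; apply: nearW => x' Xx'.
move=> B [[A1 A2] [/= n1 n2] AB]; apply: filterS n2 => z' A2z' _.
by apply: AB; split=> //; exact: nbhs_singleton.
Qed.

Lemma bfun_ge x z : X x -> Z z -> F x z <= bfun X zd zs u z.
Proof.
move=> Xx Zz; apply: ub_le_sup; last by exists x.
have [c _ cmax] := compact_EVT_max X0 cX (uext_continuous_l Zz).
by exists (F c z) => _ [x' Xx' <-]; apply: cmax; exact: mem_set.
Qed.

Lemma bfun_d : bfun X zd zs u zd = 0.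
Proof.
rewrite /bfun (_ : [set F x zd | x in X] = [set 0]) ?sup1//.
have [x Xx] := X0; apply/seteqP; split=> [_ [x' _ <-]|_ ->]; first by rewrite uext_d.
by exists x => //; rewrite uext_d.
Qed.

Lemma bfun_close z z' d : Z z -> Z z' ->
  (forall x, X x -> `|F x z - F x z'| <= d) ->
  `|bfun X zd zs u z - bfun X zd zs u z'| <= d.
Proof.
have half z1 z2 : Z z1 -> Z z2 -> (forall x, X x -> `|F x z1 - F x z2| <= d) ->
    bfun X zd zs u z1 <= bfun X zd zs u z2 + d.
  move=> Z1 Z2 F12; apply: ge_sup; first by have [x Xx] := X0; exists (F x z1), x.
  move=> _ [x Xx <-]; have := bfun_ge Xx Z2; have := F12 _ Xx.
  by have := ler_norm (F x z1 - F x z2); lra.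
move=> Zz Zz' Fzz'; rewrite ler_norml; apply/andP; split.
  have : bfun X zd zs u z' <= bfun X zd zs u z + d; last by lra.
  by apply: half => // x Xx; rewrite distrC; exact: Fzz'.
by have := half _ _ Zz Zz' Fzz'; lra.
Qed.

Section price.
Variable p : 'rV[R]_d3 -> R.
Hypothesis cp : {within Z, continuous p}.

Lemma net_continuous : {within X `*` Z, continuous
  (fun w : 'rV[R]_d1 * 'rV[R]_d3 => F w.1 w.2 - p w.2)}.
Proof.
apply/subspace_continuousP; rewrite /from_subspace => -[x z] [/= Xx Zz].
apply: cvgB.
  exact: (proj1 (subspace_continuousP _ _) uext_continuous (x, z) (conj Xx Zz)).
apply: (@within_continuous_cvg _ _ _ _ _ _ _ snd z cp) => //.
  by rewrite near_withinE; apply: nearW => x' [].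
by move=> B nB; exists (setT, B) => [|[? ?] [] //]; split=> //; exact: filterT.
Qed.

Lemma net_continuous_r x : X x -> {within Z, continuous (fun z => F x z - p z)}.
Proof.
move=> Xx; apply/subspace_continuousP; rewrite /from_subspace => z Zz; apply: cvgB.
  exact: (proj1 (subspace_continuousP _ _) (uext_continuous_r Xx) z Zz).
exact: (proj1 (subspace_continuousP _ _) cp z Zz).
Qed.

Lemma psharp_max x : X x -> exists z, [/\ Z z,
  psharp Z0 zd zs u p x = F x z - p z &
  forall z', Z z' -> F x z' - p z' <= psharp Z0 zd zs u p x].
Proof.
move=> Xx; have Z0' : Z !=set0 by exists zd.
have [z /set_mem Zz zmax] := compact_EVT_max Z0' cZ (net_continuous_r Xx).
have psE : psharp Z0 zd zs u p x = F x z - p z.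
  apply/eqP; rewrite eq_le; apply/andP; split.
    apply: ge_sup; first by exists (F x z - p z), z.
    by move=> _ [z' Zz' <-]; exact/zmax/mem_set.
  apply: ub_le_sup; last by exists z.
  by exists (F x z - p z) => _ [z' Zz' <-]; exact/zmax/mem_set.
by exists z; split=> // z' Zz'; rewrite psE; exact/zmax/mem_set.
Qed.

Lemma psharp_ge x z : X x -> Z z -> F x z - p z <= psharp Z0 zd zs u p x.
Proof. by move=> /psharp_max[z' [_ _]]; exact. Qed.

Lemma DcorrE x z : X x ->
  Dcorr Z0 zd zs u p x z <-> Z z /\ psharp Z0 zd zs u p x = F x z - p z.
Proof.
move=> Xx; split=> -[Zz zmax]; split=> //; last first.
  by move=> z' Zz'; rewrite -zmax; exact: psharp_ge.
apply/eqP; rewrite eq_le psharp_ge// andbT.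
by have [z' [Zz' -> _]] := psharp_max Xx; exact: zmax.
Qed.

(** For each fixed competitor [z'], the optimality inequality compares two functions continuous on
    [X * Z], so it survives limits. Compactness makes the graph and its projections Borel. *)
Lemma graphD_compact : compact (graphD X Z0 zd zs u p).
Proof.
have cXZ : compact (X `*` Z) by exact: compact_setX.
rewrite compact_ultra => U UU Ug.
have UXZ : U (X `*` Z) by apply: filterS Ug => w [Xw [Zw _]].
have [[x z] [[/= Xx Zz] Uxz]] : (X `*` Z) `&` [set t | U --> t] !=set0.
  by move: cXZ; rewrite compact_ultra; apply.
exists (x, z); split=> //; split=> //=; split=> // z' Zz'.
have Ux : fst @ U --> x.
  move=> B nB; apply: Uxz; exists (B, setT) => [|[? ?] [] //].
  by split=> //; exact: filterT.
have l1 : (fun w : 'rV[R]_d1 * 'rV[R]_d3 => F w.1 z' - p z') @ U --> F x z' - p z'.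
  apply: cvgB; last exact: cvg_cst.
  apply: (within_continuous_cvg _ (uext_continuous_l Zz') Xx _ Ux).
  by apply: filterS UXZ => w [].
have l2 : (fun w : 'rV[R]_d1 * 'rV[R]_d3 => F w.1 w.2 - p w.2) @ U --> F x z - p z.
  exact: (@within_continuous_cvg _ _ _ _ _ _ _ id (x, z) net_continuous).
by apply: (ler_cvg_to l1 l2); apply: filterS Ug => w [_ [_]]; exact.
Qed.

(** As the maximum is attained, a superlevel set of [psharp] is the projection of a compact
    superlevel set of net utility. This gives Borel measurability through upper semicontinuity. *)
Lemma psharp_le_compact c : compact [set x | X x /\ c <= psharp Z0 zd zs u p x].
Proof.
have cXZ : compact (X `*` Z) by exact: compact_setX.
have H := continuous_compact (f := fst) _
  (within_continuous_ge_compact (c := c) cXZ net_continuous).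
rewrite (_ : [set x | _] = fst @` [set w | (X `*` Z) w /\ c <= F w.1 w.2 - p w.2]).
  apply: H; apply: continuous_subspaceT => w; exact: cvg_fst.
apply/seteqP; split=> [x [Xx cx]|_ [[x z] [[/= Xx Zz] cxz] <-]].
  have [z [Zz psE _]] := psharp_max Xx.
  by exists (x, z) => //; rewrite /= -psE.
by split=> //; rewrite (le_trans cxz)// psharp_ge.
Qed.

Lemma psharpsharp_le z : Z z -> psharpsharp X Z0 zd zs u p z <= p z.
Proof.
move=> Zz; apply: ge_sup.
  by have [x Xx] := X0; exists (F x z - psharp Z0 zd zs u p x), x.
by move=> _ [x Xx <-]; have := psharp_ge Xx Zz; lra.
Qed.

Lemma psharpsharp_ge x z : X x -> Z z ->
  F x z - psharp Z0 zd zs u p x <= psharpsharp X Z0 zd zs u p z.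
Proof.
move=> Xx Zz; apply: ub_le_sup; last by exists x.
by exists (p z) => _ [x' Xx' <-]; have := psharp_ge Xx' Zz; lra.
Qed.

(** If [x] demands [z], the term of [x] in the supremum already equals the upper bound [p z]. *)
Lemma psharpsharp_graphD x z : graphD X Z0 zd zs u p (x, z) ->
  psharpsharp X Z0 zd zs u p z = p z.
Proof.
move=> [/= Xx /(DcorrE _ Xx)[Zz psE]]; apply/eqP; rewrite eq_le psharpsharp_le//=.
by have := psharpsharp_ge Xx Zz; rewrite psE; lra.
Qed.

(** The hypothesis on [q] says that no good yields [x] more than [psharp p x] under [q]; at [z],
    where [q] and [p] agree, this bound is attained. *)
Lemma graphD_between q x z :
  (forall z', Z z' -> psharpsharp X Z0 zd zs u p z' <= q z') ->
  graphD X Z0 zd zs u p (x, z) -> q z = p z -> graphD X Z0 zd zs u q (x, z).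
Proof.
move=> pq [/= Xx /(DcorrE _ Xx)[Zz psE]] qz; split=> //; split=> //= z' Zz'.
by have := pq _ Zz'; have := psharpsharp_ge Xx Zz'; rewrite qz -psE; lra.
Qed.

End price.

End demand.

(* The supply side is the demand side for the payoff [- v] and the price [- p],
   with the two dummy goods exchanged. *)
Section supply_as_demand.
Context (R : realType) (d2 d3 : nat) (Y : set 'rV[R]_d2) (Z0 : set 'rV[R]_d3)
  (zd zs : 'rV[R]_d3) (v : 'rV[R]_d2 -> 'rV[R]_d3 -> R).
Hypothesis zds : zd <> zs.
Local Notation nv := (fun y z => - v y z).

Lemma vextN y z : vext zd zs v y z = - uext zs zd nv y z.
Proof.
by rewrite /vext /uext; case: ifP => // _; rewrite ?oppr0//; case: ifP; rewrite opprK.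
Qed.

Let infN (S : Type) (A : set S) (f g : S -> R) : (forall s, f s = - g s) ->
  inf [set f s | s in A] = - sup [set g s | s in A].
Proof.
move=> fg; rewrite /inf; congr (- sup _); rewrite image_comp.
by apply: eq_imagel => s _ /=; rewrite fg opprK.
Qed.

Lemma afunN z : afun Y zd zs v z = - bfun Y zs zd nv z.
Proof. by apply: infN => y; exact: vextN. Qed.

Lemma pflatN p y : pflat Z0 zd zs v p y = - psharp Z0 zs zd nv (\- p) y.
Proof. by rewrite /psharp ZsetC; apply: infN => z; rewrite vextN/=; lra. Qed.

Lemma pflatflatN p z :
  pflatflat Y Z0 zd zs v p z = - psharpsharp Y Z0 zs zd nv (\- p) z.
Proof. by apply: infN => y; rewrite vextN pflatN; lra. Qed.

Lemma ScorrN p y : Scorr Z0 zd zs v p y = Dcorr Z0 zs zd nv (\- p) y.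
Proof.
rewrite /Scorr /Dcorr ZsetC; apply/seteqP; split=> z [Zz zmax]; split=> // z' Zz';
  by have := zmax z' Zz'; rewrite !vextN/=; lra.
Qed.

Lemma graphSN p : graphS Y Z0 zd zs v p = graphD Y Z0 zs zd nv (\- p).
Proof. by apply/seteqP; split=> -[y z] [/= Yy]; [rewrite ScorrN|rewrite -ScorrN]. Qed.

End supply_as_demand.

(** * Existence of an equilibrium price *)

Lemma restricted_image (d d' : measure_display) (T1 : measurableType d)
    (T2 : measurableType d') (R : realType) (m : {measure set T1 -> \bar R})
    (D : set T1) (f : T1 -> T2) : measurable D -> measurable_fun setT f ->
  exists m' : {measure set T2 -> \bar R}, forall A, m' A = m (f @^-1` A `&` D).
Proof.
move=> mD mf.
by exists (measure_function_pushforward__canonical__measure_function_Measure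
  (mrestr m mD) mf).
Qed.

(* [D] is required to be clopen along the sequences, so that no mass crosses its
   boundary in the limit. *)
Lemma marginal_limit (R : realType) (T T' : normedModType R) (U : set_system nat)
    (K : set T) (th : nat -> set T -> R) (Th : {measure set (borelType T) -> \bar R})
    (mu : {finite_measure set (borelType T') -> \bar R}) (M : R)
    (D : set (borelType T)) (pr : T -> T') :
  UltraFilter U -> \oo `<=` U -> continuous pr -> measurable D ->
  (forall n A, 0 <= th n A <= M) ->
  (forall n A B, A `&` B = set0 -> th n (A `|` B) = th n A + th n B) ->
  Th setT = (lim (th n setT @[n --> U]))%:E ->
  (forall (C : set (borelType T)) (S : nat -> set T), measurable C ->
      (forall w t, (forall n, K (w n)) -> (\forall n \near U, S n (w n)) ->
        w @ U --> t -> C t) ->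
      ((lim (th n (S n) @[n --> U]))%:E <= Th C)%E) ->
  (forall w t, (forall n, K (w n)) -> w @ U --> t ->
     (\forall n \near U, D (w n)) <-> D t) ->
  (forall n, (th n D)%:E = mu setT) ->
  (forall n (A : set (borelType T')), measurable A -> (mu A <=
    (th n [set w | D w /\ exists2 t, A t & ball (pr w) n.+1%:R^-1 t])%:E)%E) ->
  forall A : set (borelType T'), measurable A -> mu A = Th (pr @^-1` A `&` D).
Proof.
move=> UU ooU cpr mD thM thU ThT ThP clopD thD thA.
have PU : ProperFilter U by exact: ultra_proper.
have [m' m'E] := restricted_image Th mD (borel_continuous cpr).
suff H (A : set (borelType T')) : measurable A -> mu A = m' A.
  by move=> A mA; rewrite H.
move: A; apply: closed_measure_eq.
- rewrite m'E preimage_setT setTI.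
  have ThTD : Th setT = (Th D + Th (~` D))%E.
    rewrite -measureU ?setUv ?setICr//; exact: measurableC.
  have L : ((lim (th n (~` D) @[n --> U]))%:E <= Th (~` D))%E.
    apply: ThP; first exact: measurableC.
    move=> w t Kw nDw wt Dt; have Dw := (clopD w t Kw wt).2 Dt.
    by have [n []] := filter_ex (filterI Dw nDw).
  have fmu : mu setT \is a fin_num by exact: fin_num_measure.
  have ThTE : Th setT = (mu setT + (lim (th n (~` D) @[n --> U]))%:E)%E.
    rewrite ThT -(fineK fmu) -EFinD; congr EFin; apply/cvg_lim => //.
    have -> : (fun n => th n setT) = (fun n => fine (mu setT) + th n (~` D)).
      by apply/funext => n; rewrite -(thD n)/= -thU ?setUv// setICr.
    by apply: cvgD; [exact: cvg_cst|exact: ultra_bounded_cvg (fun n => thM n _)].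
  rewrite -(@leeD2rE _ (lim (th n (~` D) @[n --> U]))%:E)// -ThTE ThTD.
  exact: leeD2l.
- by rewrite -ge0_fin_numE//; exact: fin_num_measure.
move=> A cA; have mA : measurable A by exact: borel_closed.
have fA : mu A \is a fin_num by exact: fin_num_measure.
pose S n := [set w | D w /\ exists2 t, A t & ball (pr w) n.+1%:R^-1 t].
apply: (@le_trans _ _ (lim (th n (S n) @[n --> U]))%:E).
  apply: (@le_trans _ _ (fine (mu A))%:E); first by rewrite fineK.
  rewrite lee_fin; apply: limr_ge.
    by apply: cvgP; exact: ultra_bounded_cvg (fun n => thM n _).
  by apply: nearW => n; rewrite -lee_fin fineK//; exact: thA.
rewrite m'E; apply: ThP.
  by apply: measurableI => //; exact: borel_preimage.
(* Points of [A] within [1/(n+1)] of [pr (w n)] accumulate at [pr t], which therefore lies in the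
   closed set [A]. *)
move=> w t Kw Sw wt; split; last first.
  by apply/(clopD w t Kw wt); apply: filterS Sw => n [].
apply: cA => B /nbhs_ballP[e /= e0 eB].
have [k ke] := ltr_add_invr (divr_gt0 e0 (ltr0Sn R 1)); rewrite add0r in ke.
have prt : (pr \o w) @ U --> pr t by apply: cvg_comp wt _; exact: cpr.
have prw : \forall n \near U, ball (pr t) (e / 2) (pr (w n)).
  by apply: prt; apply: nbhsx_ballx; exact: divr_gt0.
have Uk : \forall n \near U, (k <= n)%N by apply: ooU; exact: nbhs_infty_ge.
have [n [[/= [_ [a Aa an]] wn] kn]] := filter_ex (filterI (filterI Sw prw) Uk).
exists a; split=> //; apply: eB; rewrite (splitr e).
apply: (ball_triangle wn); apply: le_ball an.
by apply: le_trans (ltW ke); rewrite lef_pV2 ?posrE// ler_nat ltnS.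
Qed.

Section existence.
Context (R : realType) (d1 d2 d3 : nat).
Local Notation V1 := 'rV[R]_d1.
Local Notation V2 := 'rV[R]_d2.
Local Notation V3 := 'rV[R]_d3.
Variables (X : set V1) (Y : set V2) (Z0 : set V3) (zd zs : V3)
  (u : V1 -> V3 -> R) (v : V2 -> V3 -> R)
  (mu : {finite_measure set (borelType V1) -> \bar R})
  (nu : {finite_measure set (borelType V2) -> \bar R}).
Hypotheses (cX : compact X) (X0 : X !=set0) (cY : compact Y) (Y0 : Y !=set0).
Hypotheses (cZ0 : compact Z0) (zds : zd <> zs) (Z0d : ~ Z0 zd) (Z0s : ~ Z0 zs).
Hypotheses (muX : mu (~` X : set (borelType V1)) = 0%E)
  (nuY : nu (~` Y : set (borelType V2)) = 0%E).
Hypothesis cu : forall w : V1 * V3, X w.1 -> Z0 w.2 ->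
  {for w, continuous (fun w : V1 * V3 => u w.1 w.2)}.
Let nv : V2 -> V3 -> R := fun y z => - v y z.
Hypothesis cnv : forall w : V2 * V3, Y w.1 -> Z0 w.2 ->
  {for w, continuous (fun w : V2 * V3 => nv w.1 w.2)}.
Local Notation Z := (Zset Z0 zd zs).
Local Notation F := (uext zd zs u).
Local Notation G := (vext zd zs v).
Local Notation W := (V1 * (V2 * V3))%type.

Let zsd : zs <> zd. Proof. exact/nesym. Qed.
Let Zd : Z zd. Proof. by left; right. Qed.
Let Zs : Z zs. Proof. by right. Qed.
Let cZ : compact Z. Proof. exact: Zset_compact. Qed.

Let GE : G = (fun y z => - uext zs zd nv y z).
Proof. by apply/funext => y; apply/funext => z; exact: vextN. Qed.

Let argmaxFG x y : X x -> Y y -> exists2 z, Z z &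
  forall z', Z z' -> F x z' - G y z' <= F x z - G y z.
Proof.
move=> Xx Yy; have Z0' : Z !=set0 by exists zd.
have c : {within Z, continuous (fun z => F x z - G y z)}.
  apply/subspace_continuousP; rewrite /from_subspace => z Zz.
  apply: cvgB.
    exact: (proj1 (subspace_continuousP _ _)
      (uext_continuous_r cZ0 zds Z0d Z0s cu Xx) z Zz).
  rewrite GE; apply: cvgN; rewrite -ZsetC in Zz *.
  exact: (proj1 (subspace_continuousP _ _)
      (uext_continuous_r cZ0 zsd Z0s Z0d cnv Yy) z Zz).
have [z /set_mem Zz zmax] := compact_EVT_max Z0' cZ c.
by exists z => // z' Zz'; exact/zmax/mem_set.
Qed.

Let vext_near_uniform z e : Z z -> 0 < e ->
  \forall z' \near within Z (nbhs z), forall y, Y y -> `|G y z' - G y z| <= e.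
Proof.
rewrite -ZsetC => Zz e0.
have := uext_near_uniform cY cZ0 zsd Z0s Z0d cnv Zz e0.
apply: filterS => z' H y Yy; rewrite !vextN// -opprD normrN; exact: H.
Qed.

Let afun_le y z : Y y -> Z z -> afun Y zd zs v z <= G y z.
Proof.
rewrite -ZsetC => Yy Zz; rewrite afunN// vextN// lerN2.
exact: (bfun_ge cY Y0 cZ0 zsd Z0s Z0d cnv).
Qed.

Let afun_close z z' d : Z z -> Z z' -> (forall y, Y y -> `|G y z - G y z'| <= d) ->
  `|afun Y zd zs v z - afun Y zd zs v z'| <= d.
Proof.
rewrite -ZsetC => Zz Zz' Gzz'; rewrite !afunN// -opprD normrN.
apply: (bfun_close cY Y0 cZ0 zsd Z0s Z0d cnv) => // y Yy.
by have := Gzz' y Yy; rewrite !vextN// -opprD normrN.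
Qed.

Lemma equilibrium_price_exists : exists p, equilibrium_price X Y Z0 zd zs u v mu nu p.
Proof.
have [U [UU ooU]] := free_ultrafilter.
have PU : ProperFilter U by exact: ultra_proper.
pose a := afun Y zd zs v; pose b := bfun X zd zs u.
have aG y z : Y y -> Z0 z -> a z <= G y z.
  by move=> Yy Z0z; apply: afun_le => //; left; left.
have Fb x z : X x -> Z0 z -> F x z <= b z.
  by move=> Xx Z0z; apply: (bfun_ge cX X0 cZ0 zds Z0d Z0s cu) => //; left; left.
have e0 n : 0 < n.+1%:R^-1 :> R by rewrite invr_gt0.
have Gs y : G y zs = 0 by rewrite vextN// uext_d oppr0.
have Gd y : G y zd = 1 by rewrite vextN// uext_s// opprK.
have /choice[th /choice[P /choice[S app]]] := fun n : nat =>
  approximate_equilibrium cX cY X0 Y0 zds Z0d Z0s (uext_d zd zs u) (uext_s u zds)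
    Gs Gd aG Fb argmaxFG muX nuY (e0 n).
have th_ge0 n A : 0 <= th n A by case: (app n) => -[H _] _ _ _ _; exact: H.
have thU n A B : A `&` B = set0 -> th n (A `|` B) = th n A + th n B.
  by case: (app n) => -[_ H] _ _ _ _; exact: H.
have th_sub n A B : A `<=` B -> th n A <= th n B.
  move=> AB; rewrite -(setDUK AB) thU ?lerDl//.
  by rewrite setDE setICA setICr setI0.
pose K : set W := X `*` (Y `*` Z).
have KS n : S n `<=` K.
  by case: (app n) => _ [_ SK] _ _ _ w /SK[].
have thS n : th n (~` S n) = 0 by case: (app n) => _ [].
have thK n : th n (~` K) = 0.
  by apply/eqP; rewrite eq_le th_ge0 andbT -(thS n); apply/th_sub/subsetC/KS.
have thd n : (th n [set w | w.2.2 <> zs])%:E = mu setT by case: (app n) => _ _ _ [].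
have ths n : (th n [set w | w.2.2 <> zd])%:E = nu setT by case: (app n) => _ _ _ _ [].
pose M := fine (mu setT) + fine (nu setT).
have th_le n : th n setT <= M.
  rewrite /M -(thd n) -(ths n)/= -(setUv [set w : W | w.2.2 <> zs]).
  rewrite thU ?setICr// lerD2l; apply: th_sub => w /= /contrapT ->; exact/nesym.
have thM n A : 0 <= th n A <= M.
  by rewrite th_ge0/= (le_trans _ (th_le n))//; exact: th_sub.
have cK : compact K by apply: compact_setX => //; exact: compact_setX.
have K0 : K !=set0.
  by have [x Xx] := X0; have [y Yy] := Y0; exists (x, (y, zd)); split=> //; split.
have [Th [ThT ThP]] := limit_measure UU ooU cK K0 th_ge0 thU th_le thK.
have Pd n : P n zd = 0 by case: (app n) => _ _ [].
have Ps n : P n zs = 0 by case: (app n) => _ _ [].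
have Pab n z : Z0 z -> a z <= P n z <= Num.max (a z) (b z).
  by case: (app n) => _ _ [_ _ H _] _ _; exact: H.
pose p z := lim (P n z @[n --> U]).
have pP z : Z z -> P n z @[n --> U] --> p z.
  move=> [[Z0z|/= ->]|/= ->].
  - exact: ultra_bounded_cvg (fun n => Pab n z Z0z).
  - by apply: (@ultra_bounded_cvg _ _ _ UU _ 0 0) => n; rewrite Pd lexx.
  - by apply: (@ultra_bounded_cvg _ _ _ UU _ 0 0) => n; rewrite Ps lexx.
(* Equicontinuity: the neighbourhood of [z] does not depend on [n], since it is dictated by the
   payoffs, uniformly over buyers and sellers. *)
have Puniform z e : Z z -> 0 < e ->
    \forall z' \near within Z (nbhs z), forall n, `|P n z' - P n z| <= e.
  move=> Zz ee.
  have isol z0 : (\forall z \near z0, Z z -> z = z0) ->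
      \forall z' \near within Z (nbhs z0), forall n, `|P n z' - P n z0| <= e.
    move=> H; rewrite near_withinE; apply: filterS H => z' H Zz' n.
    by rewrite (H Zz') subrr normr0 ltW.
  case: (Zz) => [[Z0z|/= ->]|/= ->].
  - have := vext_near_uniform Zz ee.
    have := uext_near_uniform cX cZ0 zds Z0d Z0s cu Zz ee.
    have := near_Z0 Z0d Z0s Z0z.
    rewrite !near_withinE => H1 H2 H3.
    apply: filterS (filterI H1 (filterI H2 H3)) => z' [h1 [h2 h3]] Zz' n.
    case: (app n) => _ _ [_ _ _ H] _ _; apply: H => //; first exact: h1.
      by apply: afun_close => //; exact: h3.
    exact: h2.
  - by apply: isol; apply: near_zd.
  - by apply: isol; rewrite -ZsetC; apply: near_zd.
have cp : {within Z, continuous p}.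
  apply/subspace_continuousP; rewrite /from_subspace => z Zz.
  apply/cvgrPdist_le => e ee; have := Puniform z e Zz ee; rewrite !near_withinE.
  apply: filterS => z' H Zz'.
  have c : `|P n z - P n z'| @[n --> U] --> `|p z - p z'|.
    by apply: cvg_norm; apply: cvgB; exact: pP.
  apply: (@closed_cvg _ _ U _ _ [set x | x <= e] _ _ _ c); first exact: closed_le.
  by apply: nearW => n; rewrite /= distrC; exact: H.
have c1 : continuous (fun w : W => w.1) by move=> w; exact: cvg_fst.
have c21 : continuous (fun w : W => w.2.1).
  by move=> w; apply: (@continuous_comp _ _ _ snd fst); [exact: cvg_snd|exact: cvg_fst].
have c22 : continuous (fun w : W => w.2.2).
  by move=> w; apply: (@continuous_comp _ _ _ snd snd); exact: cvg_snd.
have xcvg (w : nat -> W) (t : W) : w @ U --> t -> (w n).1 @[n --> U] --> t.1.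
  by move=> wt; exact: (cvg_comp w _ wt (@c1 t)).
have ycvg (w : nat -> W) (t : W) : w @ U --> t -> (w n).2.1 @[n --> U] --> t.2.1.
  by move=> wt; exact: (cvg_comp w _ wt (@c21 t)).
have zcvg (w : nat -> W) (t : W) : w @ U --> t -> (w n).2.2 @[n --> U] --> t.2.2.
  by move=> wt; exact: (cvg_comp w _ wt (@c22 t)).
have closK (w : nat -> W) (t : W) : (forall n, K (w n)) -> w @ U --> t -> K t.
  move=> Kw wt; have clK : closed K.
    by apply: compact_closed => //; exact: norm_hausdorff.
  exact: (@closed_cvg _ _ U _ w K clK (nearW _ Kw) t wt).
(* The clopen condition for [z <> z0]: it is open because points are closed, and closed along
   sequences in [K] because [z0] is isolated in [Z]. *)
have clop (z0 : V3) : (\forall z \near z0, Z z -> z = z0) ->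
    forall (w : nat -> W) (t : W), (forall n, K (w n)) -> w @ U --> t ->
    (\forall n \near U, (w n).2.2 <> z0) <-> t.2.2 <> z0.
  move=> nz0 w t Kw wt; split.
    move=> nw tz; rewrite -tz in nz0 nw.
    have nw' : \forall n \near U, Z (w n).2.2 -> (w n).2.2 = t.2.2.
      exact: (zcvg w t wt _ nz0).
    have [n [/= tn nt]] := filter_ex (filterI nw' nw).
    by apply: nt; apply: tn; case: (Kw n) => _ [].
  move=> tz; have H := near_notin_compact (@compact_set1 _ z0) (tz : ~ [set z0] t.2.2).
  exact: (zcvg w t wt _ H).
have nzd : \forall z \near zd, Z z -> z = zd by exact: near_zd.
have nzs : \forall z \near zs, Z z -> z = zs by rewrite -ZsetC; exact: near_zd.
(* Equicontinuity upgrades pointwise convergence of the prices to convergence along moving goods. *)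
have Pw_cvg (w : nat -> W) (t : W) : (forall n, K (w n)) -> w @ U --> t ->
    P n (w n).2.2 @[n --> U] --> p t.2.2.
  move=> Kw wt; have [_ [_ Zt]] := closK w t Kw wt.
  have d0 : P n (w n).2.2 - P n t.2.2 @[n --> U] --> 0.
    apply/cvgr0Pnorm_le => e ee.
    have := Puniform t.2.2 e Zt ee; rewrite near_withinE => H.
    have H' : \forall n \near U, Z (w n).2.2 ->
        forall m, `|P m (w n).2.2 - P m t.2.2| <= e by exact: (zcvg w t wt _ H).
    by apply: filterS H' => n /= H'; apply: H'; case: (Kw n) => _ [].
  rewrite -[p _]add0r (_ : (fun n => P n (w n).2.2) =
    (fun n => P n (w n).2.2 - P n t.2.2 + P n t.2.2)).
    by apply: cvgD d0 _; exact: pP.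
  by apply/funext => n; rewrite subrK.
have eps0 : n.+1%:R^-1 @[n --> U] --> (0 : R).
  by move=> B /(cvg_harmonic (R := R)) nB; exact: ooU.
have limD (w : nat -> W) (t : W) : (forall n, K (w n)) ->
    (\forall n \near U, S n (w n)) -> w @ U --> t ->
    t.2.2 <> zs -> graphD X Z0 zd zs u p (t.1, t.2.2).
  move=> Kw Sw wt /(clop zs nzs w t Kw wt) nzw.
  have [Xt [Yt Zt]] := closK w t Kw wt.
  split=> //; split=> // z Zz.
  have l1 : F (w n).1 z - P n z @[n --> U] --> F t.1 z - p z.
    apply: cvgB; last exact: pP.
    apply: (@within_continuous_cvg _ _ _ _ _ X (F^~ z) (fun n => (w n).1)) => //.
    - exact: (uext_continuous_l cZ0 zds Z0d Z0s cu).
    - by apply: nearW => n; case: (Kw n).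
    - exact: xcvg.
  have l2 : F (w n).1 (w n).2.2 - P n (w n).2.2 + n.+1%:R^-1 @[n --> U] -->
      F t.1 t.2.2 - p t.2.2.
    rewrite -[F _ _ - _]addr0; apply: cvgD => //; apply: cvgB; last exact: Pw_cvg.
    apply: (@within_continuous_cvg _ _ _ _ _ (X `*` Z)
      (fun w : V1 * V3 => F w.1 w.2) (fun n => ((w n).1, (w n).2.2)) (t.1, t.2.2)) => //.
    - exact: (uext_continuous cZ0 zds Z0d Z0s cu).
    - by apply: nearW => n; case: (Kw n) => ? [].
    - apply: cvg_to_pair; [exact: xcvg|exact: zcvg].
  apply: (ler_cvg_to l1 l2); apply: filterS (filterI Sw nzw) => n [/= Sn nzn].
  by case: (app n) => _ [_ /(_ _ Sn)[_ _ _ H _]] _ _ _; exact: H.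
have limS (w : nat -> W) (t : W) : (forall n, K (w n)) ->
    (\forall n \near U, S n (w n)) -> w @ U --> t ->
    t.2.2 <> zd -> graphS Y Z0 zd zs v p (t.2.1, t.2.2).
  move=> Kw Sw wt /(clop zd nzd w t Kw wt) nzw.
  have [Xt [Yt Zt]] := closK w t Kw wt.
  split=> //; split=> // z Zz.
  have l1 : G (w n).2.1 z - P n z + n.+1%:R^-1 @[n --> U] --> G t.2.1 z - p z.
    rewrite -[G _ _ - _]addr0; apply: cvgD => //; apply: cvgB; last exact: pP.
    rewrite GE; apply: cvgN.
    apply: (@within_continuous_cvg _ _ _ _ _ Y (uext zs zd nv ^~ z)
      (fun n => (w n).2.1)) => //.
    - by apply: (uext_continuous_l cZ0 zsd Z0s Z0d cnv); rewrite ZsetC.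
    - by apply: nearW => n; case: (Kw n) => ? [].
    - exact: ycvg.
  have l2 : G (w n).2.1 (w n).2.2 - P n (w n).2.2 @[n --> U] -->
      G t.2.1 t.2.2 - p t.2.2.
    apply: cvgB; last exact: Pw_cvg.
    rewrite GE; apply: cvgN.
    apply: (@within_continuous_cvg _ _ _ _ _ (Y `*` Z)
      (fun w : V2 * V3 => uext zs zd nv w.1 w.2) (fun n => ((w n).2.1, (w n).2.2))
      (t.2.1, t.2.2)) => //.
    - by rewrite -ZsetC; exact: (uext_continuous cZ0 zsd Z0s Z0d cnv).
    - by apply: nearW => n; case: (Kw n) => ? [].
    - apply: cvg_to_pair; [exact: ycvg|exact: zcvg].
  apply: (ler_cvg_to l2 l1); apply: filterS (filterI Sw nzw) => n [/= Sn nzn].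
  by case: (app n) => _ [_ /(_ _ Sn)[_ _ _ _ H]] _ _ _; exact: H.
have mp (z0 : V3) : measurable ([set w | w.2.2 <> z0] : set (borelType W)).
  apply: (@borel_preimage _ _ _ _ (~` [set z0]) c22).
  by apply: measurableC; apply: borel_compact; exact: compact_set1.
have c13 : continuous (fun w : W => (w.1, w.2.2)).
  by move=> w; apply: cvg_to_pair; [exact: c1|exact: c22].
have c23 : continuous (fun w : W => (w.2.1, w.2.2)).
  by move=> w; apply: cvg_to_pair; [exact: c21|exact: c22].
(* Since [th n] is carried by [S n], a Borel set containing all limits of points of [S n] receives
   the full mass of the finite measure [Th]. *)
have full (C : set (borelType W)) : measurable C ->
    (forall (w : nat -> W) (t : W), (forall n, K (w n)) ->
      (\forall n \near U, S n (w n)) -> w @ U --> t -> C t) -> Th (~` C) = 0%E.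
  move=> mC CP; have mC' : measurable (~` C) by exact: measurableC.
  have ThC : (Th setT <= Th C)%E.
    rewrite ThT (_ : (fun n => th n setT) = (fun n => th n (S n))); first exact: ThP.
    by apply/funext => n; rewrite -(setUv (S n)) thU ?setICr// thS addr0.
  have fC : Th C \is a fin_num.
    rewrite ge0_fin_numE// (@le_lt_trans _ _ (Th setT))//; last by rewrite ThT ltry.
    by apply: le_measure; rewrite ?inE.
  apply/eqP; rewrite eq_le measure_ge0 andbT -(@leeD2lE _ (Th C))// adde0.
  by rewrite -measureU// ?setUv ?setICr.
have [alpha alphaE] := restricted_image Th (mp zs) (borel_continuous c13).
have [beta betaE] := restricted_image Th (mp zd) (borel_continuous c23).
have mgD : measurable (graphD X Z0 zd zs u p : set (borelType (V1 * V3)%type)).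
  apply: borel_compact; exact: (graphD_compact cX cZ0 zds Z0d Z0s cu cp).
have cnp : {within Zset Z0 zs zd, continuous (\- p)}.
  rewrite ZsetC; apply/subspace_continuousP; rewrite /from_subspace => z Zz.
  by apply: cvgN; exact: (proj1 (subspace_continuousP _ _) cp z Zz).
have mgS : measurable (graphS Y Z0 zd zs v p : set (borelType (V2 * V3)%type)).
  rewrite graphSN//; apply: borel_compact.
  exact: (graphD_compact cY cZ0 zsd Z0s Z0d cnv cnp).
have p_d : p zd = 0.
  by apply/cvg_lim => //; under eq_fun do rewrite Pd; exact: cvg_cst.
have p_s : p zs = 0.
  by apply/cvg_lim => //; under eq_fun do rewrite Ps; exact: cvg_cst.
exists p, alpha, beta; split.
(* On [Z1] the bound [Num.max (a z) (b z)] is [b z]. At [zd] the upper bound [b] is 0 and at [zs]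
   the lower bound [a] is 0, so there the other inequality is [a z <= b z] itself. *)
- split=> // z [[[Z0z|/= ->]|/= ->] ab].
  + have Zz : Z z by left; left.
    have cz : cvg (P n z @[n --> U]) by apply: cvgP; exact: pP.
    apply/andP; split.
      by apply: limr_ge cz _; apply: nearW => n; have /andP[] := Pab n z Z0z.
    apply: limr_le cz _; apply: nearW => n; have /andP[_] := Pab n z Z0z.
    by rewrite /b /a max_r.
  + have b0 : bfun X zd zs u zd = 0 by exact: bfun_d.
    by rewrite p_d b0 lexx andbT -b0.
  + have as0 : afun Y zd zs v zs = 0 by rewrite afunN// bfun_d ?oppr0.
    by rewrite p_s as0 lexx/= -as0.
- split.
    exists (~` graphD X Z0 zd zs u p); split=> //; first exact: measurableC.
    rewrite alphaE -(setCK (_ `&` _)); apply: full.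
      apply: measurableC; apply: measurableI => //.
      by apply: (borel_preimage c13); exact: measurableC.
    move=> w t Kw Sw wt [/= ng tzs]; apply: ng; exact: limD Kw Sw wt tzs.
  move=> A mA; rewrite alphaE.
  transitivity (Th (fst @^-1` A `&` [set w : W | w.2.2 <> zs])).
    by congr (Th _); apply/seteqP; split=> w /= [] // [].
  apply/esym/(@marginal_limit _ _ _ U K th Th mu M
    [set w | w.2.2 <> zs] fst UU ooU c1 (mp zs) thM thU ThT ThP (clop zs nzs) thd) => //.
  by move=> n B mB; case: (app n) => _ _ _ [_ H] _; exact: H.
- split.
    exists (~` graphS Y Z0 zd zs v p); split=> //; first exact: measurableC.
    rewrite betaE -(setCK (_ `&` _)); apply: full.
      apply: measurableC; apply: measurableI => //.
      by apply: (borel_preimage c23); exact: measurableC.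
    move=> w t Kw Sw wt [/= ng tzs]; apply: ng; exact: limS Kw Sw wt tzs.
  move=> A mA; rewrite betaE.
  transitivity (Th ((fun w : W => w.2.1) @^-1` A `&` [set w : W | w.2.2 <> zd])).
    by congr (Th _); apply/seteqP; split=> w /= [] // [].
  apply/esym/(@marginal_limit _ _ _ U K th Th nu M
    [set w | w.2.2 <> zd] (fun w => w.2.1) UU ooU c21 (mp zd) thM thU ThT ThP
    (clop zd nzd) ths) => //.
  by move=> n B mB; case: (app n) => _ _ _ _ [_ H]; exact: H.
- move=> A mA AZ0; rewrite /alphaZ /betaZ alphaE betaE; congr (Th _).
  apply/seteqP; split=> w /= [[_ Aw] _]; split=> // wz; have := AZ0 _ Aw;
    by rewrite wz.
Qed.

End existence.

(** * Interchange of equilibria *)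

Definition bounded_borel (R : realType) (T : normedModType R) (f : T -> R) : Prop :=
  measurable_fun setT (f : borelType T -> R) /\ exists M, forall t, `|f t| <= M.

(** * Means of bounded Borel functions against finite measures *)

Section integrals.
Context (R : realType).

Lemma bounded_borel_integrable (T : normedModType R)
    (m : {measure set (borelType T) -> \bar R}) (f : T -> R) :
  (m setT < +oo)%E -> bounded_borel f -> m.-integrable setT (EFin \o f).
Proof.
move=> moo [mf [M fM]]; apply: measurable_bounded_integrable => //.
by exists M; split=> [|x Mx t _]; [exact: num_real|exact: (le_trans (fM t)) (ltW Mx)].
Qed.

Lemma bounded_borel_comp (T T' : normedModType R) (pr : T -> T') (f : T' -> R) :
  continuous pr -> bounded_borel f -> bounded_borel (f \o pr).
Proof.
move=> cpr [mf [M fM]]; split; last by exists M => t; exact: fM.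
exact: (measurableT_comp mf (borel_continuous cpr)).
Qed.

Lemma bounded_borelD (T : normedModType R) (f g : T -> R) :
  bounded_borel f -> bounded_borel g -> bounded_borel (fun t => f t + g t).
Proof.
move=> [mf [M fM]] [mg [N gN]]; split; first exact: measurable_funD.
by exists (M + N) => t; rewrite (le_trans (ler_normD _ _))// lerD.
Qed.

Lemma bounded_borelN (T : normedModType R) (f : T -> R) :
  bounded_borel f -> bounded_borel (fun t => - f t).
Proof.
move=> [mf [M fM]]; split; first exact: measurable_funN.
by exists M => t; rewrite normrN.
Qed.

Definition mean (T : normedModType R) (m : {measure set (borelType T) -> \bar R})
  (f : T -> R) : R := fine (\int[m]_t (f t)%:E).

Lemma meanE (T : normedModType R) (m : {measure set (borelType T) -> \bar R})
    (f : T -> R) : (m setT < +oo)%E -> bounded_borel f ->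
  (\int[m]_t (f t)%:E = (mean m f)%:E)%E.
Proof.
move=> moo bf; rewrite fineK//; apply: integrable_fin_num => //.
exact: bounded_borel_integrable.
Qed.

Lemma meanD (T : normedModType R) (m : {measure set (borelType T) -> \bar R})
    (f g : T -> R) : (m setT < +oo)%E -> bounded_borel f -> bounded_borel g ->
  mean m (fun t => f t + g t) = mean m f + mean m g.
Proof.
move=> moo bf bg; apply: EFin_inj; rewrite EFinD -!meanE//; last first.
  exact: bounded_borelD.
under eq_integral do rewrite EFinD.
by rewrite integralD//; exact: bounded_borel_integrable.
Qed.

Lemma meanN (T : normedModType R) (m : {measure set (borelType T) -> \bar R})
    (f : T -> R) : (m setT < +oo)%E -> bounded_borel f ->
  mean m (fun t => - f t) = - mean m f.
Proof.
move=> moo bf; apply/eqP; rewrite -addr_eq0 -meanD//; last exact: bounded_borelN.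
rewrite /mean; under eq_integral do rewrite addrC subrr.
by rewrite integral0.
Qed.

Lemma mean_pushforward (T T' : normedModType R)
    (m : {measure set (borelType T) -> \bar R})
    (m' : {measure set (borelType T') -> \bar R}) (pr : T -> T') (f : T' -> R) :
  (m setT < +oo)%E -> continuous pr -> bounded_borel f ->
  (forall A : set (borelType T'), measurable A -> m (pr @^-1` A) = m' A) ->
  mean m (f \o pr) = mean m' f.
Proof.
move=> moo cpr bf mm'; rewrite /mean; congr fine.
have mpr := borel_continuous cpr.
pose mp := measure_function_pushforward__canonical__measure_function_Measure m mpr.
transitivity (\int[mp]_t (f t)%:E)%E.
  rewrite (integral_pushforward mpr)//.
  - by apply/measurable_EFinP; exact: bf.1.
  - rewrite preimage_setT.
    exact: (bounded_borel_integrable moo (bounded_borel_comp cpr bf)).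
by apply: eq_measure_integral => A mA _; rewrite -mm'.
Qed.

(** Fits the clearing condition, which compares the marginals only inside [Z0], while price terms
    are cut off outside it. *)
Lemma mean_supported (T : normedModType R)
    (m m' : {measure set (borelType T) -> \bar R}) (D : set (borelType T)) (f : T -> R) :
  (forall t, ~ D t -> f t = 0) ->
  (forall A : set (borelType T), measurable A -> A `<=` D -> m A = m' A) ->
  mean m f = mean m' f.
Proof.
move=> fD mm'; rewrite /mean; congr fine.
have -> : (fun t => (f t)%:E) = (fun t => (f t)%:E) \_ D.
  apply/funext => t; rewrite patchE; case: ifPn => // /negP nD.
  by rewrite fD// => Dt; apply: nD; exact: mem_set.
by rewrite -!(integral_mkcond D); exact: eq_measure_integral.
Qed.

Lemma mean_ge0 (T : normedModType R) (m : {measure set (borelType T) -> \bar R})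
    (E : set (borelType T)) (f : T -> R) : (m setT < +oo)%E -> bounded_borel f ->
  measurable E -> m (~` E) = 0%E -> (forall t, E t -> 0 <= f t) ->
  0 <= mean m f /\ (mean m f = 0 ->
    m.-negligible ([set t | E t /\ f t <> 0] : set (borelType T))).
Proof.
move=> moo bf mE mE0 f0.
have mCE : measurable (~` E) by exact: measurableC.
have intf := bounded_borel_integrable moo bf.
have meanEE : mean m f = fine (\int[m]_(t in E) (f t)%:E)%E.
  by rewrite /mean (negligible_integral mCE)// setDE setCK setTI.
have intE_ge0 : (0 <= \int[m]_(t in E) (f t)%:E)%E.
  by apply: integral_ge0 => t Et; rewrite lee_fin f0.
rewrite meanEE; split; first exact: fine_ge0.
have fin : (\int[m]_(t in E) (f t)%:E)%E \is a fin_num.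
  by apply: integrable_fin_num => //; exact: (integrableS measurableT).
move=> int0.
have mfE : measurable_fun E (EFin \o f).
  by apply/measurable_EFinP; apply: measurable_funTS; exact: bf.1.
have : (\int[m]_(t in E) `|(EFin \o f) t| = 0)%E.
  rewrite -[RHS]/(0%:E) -int0 fineK//; apply: eq_integral => t /set_mem Et.
  by rewrite gee0_abs// lee_fin f0.
move=> /(ae_eq_integral_abs m mE mfE); rewrite /ae_eq.
case=> N [mN mN0 subN]; exists N; split => // t [Et ft]; apply: subN => /= /(_ Et).
by case.
Qed.

End integrals.

(** The half-lines [[c, +oo[] generate the Borel sets of the line, and their preimages in [K] are
    compact, hence Borel. *)
Lemma bounded_borel_patch (R : realType) (T : normedModType R) (K : set T) (f : T -> R) :
  compact K -> (forall c, compact [set t | K t /\ c <= f t]) ->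
  (exists M, forall t, K t -> `|f t| <= M) -> bounded_borel (f \_ K).
Proof.
move=> cK cf [M fM]; split; last first.
  exists `|M| => t; rewrite patchE; case: ifPn => [/set_mem Kt|_]; last first.
    by rewrite normr0.
  by rewrite (le_trans (fM t Kt))// ler_norm.
have mK : measurable (K : set (borelType T)) by exact: borel_compact.
apply/(measurable_restrictT _ mK) => _.
apply: (measurability _ (RGenCInfty.measurableE R)) => // _ [_ [c ->] <-].
rewrite (_ : _ `&` _ = [set t | K t /\ c <= f t]); first exact: borel_compact.
by apply/seteqP; split=> t /=; rewrite in_itv/= andbT.
Qed.

Section gap.
Context (R : realType) (d1 d3 : nat) (X : set 'rV[R]_d1) (Z0 : set 'rV[R]_d3)
  (zd zs : 'rV[R]_d3) (u : 'rV[R]_d1 -> 'rV[R]_d3 -> R).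
Hypotheses (cX : compact X) (X0 : X !=set0).
Hypotheses (cZ0 : compact Z0) (zds : zd <> zs) (Z0d : ~ Z0 zd) (Z0s : ~ Z0 zs).
Hypothesis cu : forall w : 'rV[R]_d1 * 'rV[R]_d3, X w.1 -> Z0 w.2 ->
  {for w, continuous (fun w : 'rV[R]_d1 * 'rV[R]_d3 => u w.1 w.2)}.
Local Notation Z := (Zset Z0 zd zs).
Local Notation F := (uext zd zs u).

Let cZ : compact Z. Proof. exact: Zset_compact. Qed.

Lemma psharp_bounded_borel p : {within Z, continuous p} ->
  bounded_borel (psharp Z0 zd zs u p \_ X).
Proof.
move=> cp; apply: bounded_borel_patch => // [c|].
  exact: (psharp_le_compact cX cZ0 zds Z0d Z0s cu).
have [M FM] := within_continuous_bounded (compact_setX cX cZ)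
  (net_continuous cZ0 zds Z0d Z0s cu cp).
exists M => x Xx; have [z [Zz -> _]] := psharp_max cZ0 zds Z0d Z0s cu cp Xx.
exact: (FM (x, z)).
Qed.

Lemma price_bounded_borel p : {within Z, continuous p} -> bounded_borel (p \_ Z0).
Proof.
move=> cp; have cp0 : {within Z0, continuous p}.
  by apply: continuous_subspaceW cp => z; left; left.
apply: bounded_borel_patch => // [c|]; first exact: within_continuous_ge_compact.
exact: within_continuous_bounded.
Qed.

(* The gap [psharp q x - (F x z - q z)] is nonnegative, and on the graph of [D_p]
   it equals [(psharp q - psharp p) x + (q - p) z], where the payoff cancels. *)
Lemma mean_gap (mu : {finite_measure set (borelType 'rV[R]_d1) -> \bar R})
    (alpha : {measure set (borelType ('rV[R]_d1 * 'rV[R]_d3)%type) -> \bar R}) p q :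
  price_system Z0 zd zs p -> price_system Z0 zd zs q ->
  demand_distribution X Z0 zd zs u mu p alpha ->
  let s r := mean mu (psharp Z0 zd zs u r \_ X) in
  let m r := mean alpha ((r \_ Z0) \o snd) in
  0 <= (s q - s p) + (m q - m p) /\
  ((s q - s p) + (m q - m p) = 0 -> demand_distribution X Z0 zd zs u mu q alpha).
Proof.
move=> [cp [pd ps]] [cq [qd qs]] [negp margp] s m.
have muoo : (mu setT < +oo)%E by rewrite -ge0_fin_numE//; exact: fin_num_measure.
have aoo : (alpha setT < +oo)%E.
  rewrite (_ : setT = setT `*` setT :> set ('rV[R]_d1 * 'rV[R]_d3)).
    by rewrite margp.
  by apply/seteqP; split.
have bs r : {within Z, continuous r} -> bounded_borel (psharp Z0 zd zs u r \_ X).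
  exact: psharp_bounded_borel.
have cfst : continuous (@fst 'rV[R]_d1 'rV[R]_d3) by move=> w; exact: cvg_fst.
have csnd : continuous (@snd 'rV[R]_d1 'rV[R]_d3) by move=> w; exact: cvg_snd.
have sE r : {within Z, continuous r} ->
    mean alpha ((psharp Z0 zd zs u r \_ X) \o fst) = s r.
  move=> cr; apply: mean_pushforward => //; first exact: bs.
  move=> A mA; rewrite -margp//; congr (alpha _).
  by apply/seteqP; split=> w // [].
have bs1 r : {within Z, continuous r} ->
    bounded_borel ((psharp Z0 zd zs u r \_ X) \o @fst 'rV[R]_d1 'rV[R]_d3).
  by move=> cr; apply: bounded_borel_comp => //; exact: bs.
have bm r : {within Z, continuous r} ->
    bounded_borel ((r \_ Z0) \o @snd 'rV[R]_d1 'rV[R]_d3).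
  by move=> cr; apply: bounded_borel_comp => //; exact: price_bounded_borel.
pose f (w : 'rV[R]_d1 * 'rV[R]_d3) :=
  ((psharp Z0 zd zs u q \_ X) w.1 + - (psharp Z0 zd zs u p \_ X) w.1)
  + ((q \_ Z0) w.2 + - (p \_ Z0) w.2).
have bf : bounded_borel f.
  apply: bounded_borelD; apply: bounded_borelD.
  - exact: (bs1 _ cq).
  - exact: (bounded_borelN (bs1 _ cp)).
  - exact: (bm _ cq).
  - exact: (bounded_borelN (bm _ cp)).
have meanf : mean alpha f = (s q - s p) + (m q - m p).
  rewrite /f (meanD aoo (f := fun w => _ + - _) (g := fun w => _ + - _)); last 2 first.
  - exact: (bounded_borelD (bs1 _ cq) (bounded_borelN (bs1 _ cp))).
  - exact: (bounded_borelD (bm _ cq) (bounded_borelN (bm _ cp))).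
  rewrite (meanD aoo (bs1 _ cq) (bounded_borelN (bs1 _ cp))).
  rewrite (meanD aoo (bm _ cq) (bounded_borelN (bm _ cp))).
  by rewrite (meanN aoo (bs1 _ cp)) (meanN aoo (bm _ cp)) !sE.
(* Price systems vanish at the dummy goods, so cutting them off outside [Z0] changes nothing on
   [Z]. *)
have patchZ (r : 'rV[R]_d3 -> R) z : r zd = 0 -> r zs = 0 -> Z z -> (r \_ Z0) z = r z.
  move=> rd rs Zz; rewrite patchE; case: ifPn => // /negP nZ0.
  case: Zz => [[Z0z|/= ->]|/= ->]; last by rewrite rs.
    by exfalso; apply: nZ0; exact: mem_set.
  by rewrite rd.
have fE w : graphD X Z0 zd zs u p w ->
    f w = psharp Z0 zd zs u q w.1 - (F w.1 w.2 - q w.2).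
  move=> [Xw /(DcorrE cZ0 zds Z0d Z0s cu cp _ Xw)[Zw psE]].
  by rewrite /f !patchZ// !patchE mem_set// psE; lra.
have mE : measurable
    (graphD X Z0 zd zs u p : set (borelType ('rV[R]_d1 * 'rV[R]_d3)%type)).
  by apply: borel_compact; exact: (graphD_compact cX cZ0 zds Z0d Z0s cu cp).
have aE0 : alpha (~` graphD X Z0 zd zs u p) = 0%E.
  by apply/negligibleP => //; exact: measurableC.
have fge0 w : graphD X Z0 zd zs u p w -> 0 <= f w.
  move=> gw; rewrite fE//; case: gw => Xw [Zw _].
  by rewrite subr_ge0; exact: (psharp_ge cZ0 zds Z0d Z0s cu cq).
have [H1 H2] := mean_ge0 aoo bf mE aE0 fge0.
rewrite -meanf; split=> // /H2 neg; split=> //.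
apply: negligibleS (negligibleU negp neg) => w nq.
have [gw|ngw] := pselect (graphD X Z0 zd zs u p w); last by left.
right; split=> // fw0; apply: nq; case: (gw) => Xw [Zw _]; split=> //.
apply/(DcorrE cZ0 zds Z0d Z0s cu cq _ Xw); split=> //.
by apply/eqP; rewrite -subr_eq0 -fE// fw0.
Qed.

End gap.

(** * Exchange, convexity and the prices between the two envelopes *)

Section equilibria.
Context (R : realType) (d1 d2 d3 : nat).
Local Notation V1 := 'rV[R]_d1.
Local Notation V2 := 'rV[R]_d2.
Local Notation V3 := 'rV[R]_d3.
Variables (X : set V1) (Y : set V2) (Z0 : set V3) (zd zs : V3)
  (u : V1 -> V3 -> R) (v : V2 -> V3 -> R)
  (mu : {finite_measure set (borelType V1) -> \bar R})
  (nu : {finite_measure set (borelType V2) -> \bar R}).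
Hypotheses (cX : compact X) (X0 : X !=set0) (cY : compact Y) (Y0 : Y !=set0).
Hypotheses (cZ0 : compact Z0) (zds : zd <> zs) (Z0d : ~ Z0 zd) (Z0s : ~ Z0 zs).
Let nv : V2 -> V3 -> R := fun y z => - v y z.
Hypothesis cu : forall w : V1 * V3, X w.1 -> Z0 w.2 ->
  {for w, continuous (fun w : V1 * V3 => u w.1 w.2)}.
Hypothesis cnv : forall w : V2 * V3, Y w.1 -> Z0 w.2 ->
  {for w, continuous (fun w : V2 * V3 => nv w.1 w.2)}.
Local Notation Z := (Zset Z0 zd zs).
Local Notation F := (uext zd zs u).
Local Notation G := (vext zd zs v).
Local Notation measure_on V := {measure set (borelType V) -> \bar R}.
Local Notation equilibrium := (equilibrium X Y Z0 zd zs u v mu nu).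

Let zsd : zs <> zd. Proof. exact/nesym. Qed.

Let price_systemN p : price_system Z0 zd zs p -> price_system Z0 zs zd (\- p).
Proof.
move=> [cp [pd ps]]; split; last by rewrite /= pd ps oppr0.
rewrite ZsetC; apply/subspace_continuousP; rewrite /from_subspace => z Zz.
by apply: cvgN; exact: (proj1 (subspace_continuousP _ _) cp z Zz).
Qed.

Let supply_demand p (beta : measure_on (V2 * V3)%type) :
  supply_distribution Y Z0 zd zs v nu p beta <->
  demand_distribution Y Z0 zs zd nv nu (\- p) beta.
Proof. by rewrite /supply_distribution graphSN. Qed.

Lemma equilibrium_exchange p q (alpha alpha' : measure_on (V1 * V3)%type)
    (beta beta' : measure_on (V2 * V3)%type) :
  equilibrium p alpha beta -> equilibrium q alpha' beta' -> equilibrium q alpha beta.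
Proof.
move=> [[psp _] dp sp ab] [[psq adq] dq sq ab'].
have mass1 (al : measure_on (V1 * V3)%type) r :
    demand_distribution X Z0 zd zs u mu r al -> (al setT < +oo)%E.
  move=> [_ marg]; rewrite (_ : setT = setT `*` setT :> set (V1 * V3)).
    by rewrite marg// -ge0_fin_numE//; exact: fin_num_measure.
  by apply/seteqP; split.
have mass2 (be : measure_on (V2 * V3)%type) r :
    supply_distribution Y Z0 zd zs v nu r be -> (be setT < +oo)%E.
  move=> [_ marg]; rewrite (_ : setT = setT `*` setT :> set (V2 * V3)).
    by rewrite marg// -ge0_fin_numE//; exact: fin_num_measure.
  by apply/seteqP; split.
have csnd1 : continuous (@snd V1 V3) by move=> w; exact: cvg_snd.
have csnd2 : continuous (@snd V2 V3) by move=> w; exact: cvg_snd.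
have mean_eq (al : measure_on (V1 * V3)%type) (be : measure_on (V2 * V3)%type) r :
    price_system Z0 zd zs r -> (al setT < +oo)%E -> (be setT < +oo)%E ->
    (forall A : set (borelType V3), measurable A -> A `<=` Z0 ->
      alphaZ al A = betaZ be A) ->
    mean be (((\- r) \_ Z0) \o snd) = - mean al ((r \_ Z0) \o snd).
  move=> psr aloo beoo albe.
  have br := price_bounded_borel cZ0 psr.1.
  have brN := price_bounded_borel cZ0 (price_systemN psr).1.
  have [m1 m1E] := restricted_image al measurableT (borel_continuous csnd1).
  have [m2 m2E] := restricted_image be measurableT (borel_continuous csnd2).
  have brl : bounded_borel ((r \_ Z0) \o @snd V1 V3) by exact: bounded_borel_comp.
  rewrite -(meanN aloo brl).
  have -> : (fun w : V1 * V3 => - ((r \_ Z0) \o snd) w) = ((\- r) \_ Z0) \o snd.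
    by apply/funext => w /=; rewrite !patchE; case: ifP => // _; rewrite oppr0.
  rewrite (@mean_pushforward _ _ _ be m2 snd)// => [|A mA]; last by rewrite m2E setIT.
  rewrite (@mean_pushforward _ _ _ al m1 snd)// => [|A mA]; last by rewrite m1E setIT.
  apply: (@mean_supported _ _ _ _ Z0) => [z nZ|A mA AZ].
    by rewrite patchE memNset.
  rewrite m1E m2E !setIT; have := albe A mA AZ; rewrite /alphaZ /betaZ => e.
  rewrite (_ : @snd V1 V3 @^-1` A = setT `*` A); last by apply/seteqP; split=> w // [].
  by rewrite e; congr (be _); apply/seteqP; split=> w // [].
(* Indirect utility terms cancel between [g1] and [g2], and between [g3] and [g4], as they depend
   only on [mu], resp. [nu]. Price terms cancel between [alpha] and [beta], and between [alpha'] and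
   [beta'], by clearing. Each gap is thus 0. *)
have [g1 G1] := mean_gap cX cZ0 zds Z0d Z0s cu psp psq dp.
have [g2 G2] := mean_gap cX cZ0 zds Z0d Z0s cu psq psp dq.
have [g3 G3] := mean_gap cY cZ0 zsd Z0s Z0d cnv (price_systemN psp)
  (price_systemN psq) ((supply_demand _ _).1 sp).
have [g4 G4] := mean_gap cY cZ0 zsd Z0s Z0d cnv (price_systemN psq)
  (price_systemN psp) ((supply_demand _ _).1 sq).
have e1 := mean_eq _ _ _ psp (mass1 _ _ dp) (mass2 _ _ sp) ab.
have e2 := mean_eq _ _ _ psq (mass1 _ _ dp) (mass2 _ _ sp) ab.
have e3 := mean_eq _ _ _ psp (mass1 _ _ dq) (mass2 _ _ sq) ab'.
have e4 := mean_eq _ _ _ psq (mass1 _ _ dq) (mass2 _ _ sq) ab'.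
split=> //; first by apply: G1; lra.
by apply/supply_demand; apply: G3; lra.
Qed.

(** After the exchange, one pair [alpha], [beta] is carried by the graphs for both prices, and a
    good optimal under [p] and under [q] is optimal under every convex combination. *)
Lemma equilibrium_price_convex p q (t : R) :
  equilibrium_price X Y Z0 zd zs u v mu nu p ->
  equilibrium_price X Y Z0 zd zs u v mu nu q -> 0 <= t <= 1 ->
  equilibrium_price X Y Z0 zd zs u v mu nu (fun z => t * p z + (1 - t) * q z).
Proof.
move=> [alpha [beta Ep]] [alpha' [beta' Eq]] /andP[t0 t1].
have t1' : 0 <= 1 - t by rewrite subr_ge0.
have [[[cq [qd qs]] aq] [nq _] [nq' _] _] := equilibrium_exchange Ep Eq.
case: Ep => [[[cp [pd ps]] ap] [np mp] [np' mp'] ab].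
exists alpha, beta; split=> //.
- split.
    split; last by rewrite pd ps qd qs !mulr0 addr0.
    apply/subspace_continuousP; rewrite /from_subspace => z Zz.
    by apply: cvgD; apply: cvgMl_tmp;
      [exact: (proj1 (subspace_continuousP _ _) cp z Zz)|
       exact: (proj1 (subspace_continuousP _ _) cq z Zz)].
  move=> z Z1z; have /andP[p1 p2] := ap _ Z1z; have /andP[q1 q2] := aq _ Z1z.
  have := ler_wpM2l t0 p1; have := ler_wpM2l t0 p2.
  have := ler_wpM2l t1' q1; have := ler_wpM2l t1' q2.
  move=> *; apply/andP; split; lra.
- split=> //; apply: negligibleS (negligibleU np nq) => w nw.
  apply: contrapT => /not_orP[/contrapT[Xw [Zw maxp]] /contrapT[_ [_ maxq]]].
  apply: nw; split=> //; split=> // z' Zz'.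
  by have := ler_wpM2l t0 (maxp _ Zz'); have := ler_wpM2l t1' (maxq _ Zz'); lra.
- split=> //; apply: negligibleS (negligibleU np' nq') => w nw.
  apply: contrapT => /not_orP[/contrapT[Xw [Zw maxp]] /contrapT[_ [_ maxq]]].
  apply: nw; split=> //; split=> // z' Zz'.
  by have := ler_wpM2l t0 (maxp _ Zz'); have := ler_wpM2l t1' (maxq _ Zz'); lra.
Qed.

(* The exceptional set is the complement in [Z0] of the two compact projections
   of the graphs carrying [alpha] and [beta]. *)
Lemma equilibrium_envelopes_ae p (alpha : measure_on (V1 * V3)%type)
    (beta : measure_on (V2 * V3)%type) : equilibrium p alpha beta ->
  exists N : set (borelType V3), [/\ measurable N, N `<=` Z0,
    alphaZ alpha N = 0%E, betaZ beta N = 0%E &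
    forall z, Z0 z -> ~ N z -> psharpsharp X Z0 zd zs u p z = p z /\
                               p z = pflatflat Y Z0 zd zs v p z].
Proof.
move=> [[psp _] [np _] [np' _] ab]; have cp := psp.1; have cnp := (price_systemN psp).1.
have cgD := graphD_compact cX cZ0 zds Z0d Z0s cu cp.
have cgS : compact (graphS Y Z0 zd zs v p).
  by rewrite graphSN//; exact: (graphD_compact cY cZ0 zsd Z0s Z0d cnv cnp).
have mZ0 : measurable (Z0 : set (borelType V3)) by exact: borel_compact.
have csnd1 : continuous (@snd V1 V3) by move=> w; exact: cvg_snd.
have csnd2 : continuous (@snd V2 V3) by move=> w; exact: cvg_snd.
pose ND : set (borelType V3) := Z0 `\` (snd @` graphD X Z0 zd zs u p).
pose NS : set (borelType V3) := Z0 `\` (snd @` graphS Y Z0 zd zs v p).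
have mND : measurable ND.
  apply: measurableD => //; apply: borel_compact; apply: continuous_compact cgD.
  exact: continuous_subspaceT.
have mNS : measurable NS.
  apply: measurableD => //; apply: borel_compact; apply: continuous_compact cgS.
  exact: continuous_subspaceT.
have aD : alphaZ alpha ND = 0%E.
  have mD : measurable (setT `*` ND : set (borelType (V1 * V3)%type)).
    rewrite (_ : setT `*` ND = snd @^-1` ND); first exact: borel_preimage.
    by apply/seteqP; split=> w // [].
  apply/(negligibleP _ mD); apply: negligibleS np => w [_ [_ nw]] gw.
  by apply: nw; exists w.
have bS : betaZ beta NS = 0%E.
  have mS : measurable (setT `*` NS : set (borelType (V2 * V3)%type)).
    rewrite (_ : setT `*` NS = snd @^-1` NS); first exact: borel_preimage.
    by apply/seteqP; split=> w // [].
  apply/(negligibleP _ mS); apply: negligibleS np' => w [_ [_ nw]] gw.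
  by apply: nw; exists w.
have aS : alphaZ alpha NS = 0%E by rewrite ab// => z [].
have bD : betaZ beta ND = 0%E by rewrite -ab// => z [].
have mX (A : set (borelType V3)) : measurable A ->
    measurable (setT `*` A : set (borelType (V1 * V3)%type)).
  move=> mA; rewrite (_ : setT `*` A = snd @^-1` A); first exact: borel_preimage.
  by apply/seteqP; split=> w // [].
have aN : alphaZ alpha (ND `|` NS) = 0%E.
  have nD := (negligibleP alpha (mX _ mND)).2 aD.
  have nS := (negligibleP alpha (mX _ mNS)).2 aS.
  apply/(negligibleP _ (mX _ (measurableU _ _ mND mNS))).
  by apply: negligibleS (negligibleU nD nS) => w [_ []]; [left|right].
exists (ND `|` NS); split=> //.
- exact: measurableU.
- by move=> z [[]|[]].
- by rewrite -ab//; [exact: measurableU|move=> z [[]|[]]].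
move=> z Z0z /not_orP[nD nS]; split.
  have [[x z'] gx /= zz] : (snd @` graphD X Z0 zd zs u p) z.
    by apply: contrapT => H; apply: nD.
  by rewrite -zz; exact: (psharpsharp_graphD X0 cZ0 zds Z0d Z0s cu cp gx).
have [[y z'] gy /= zz] : (snd @` graphS Y Z0 zd zs v p) z.
  by apply: contrapT => H; apply: nS.
rewrite graphSN// in gy; rewrite pflatflatN//.
by rewrite -zz (psharpsharp_graphD Y0 cZ0 zsd Z0s Z0d cnv cnp gy) /= opprK.
Qed.

(** The distributions are kept. Off a null set of goods the envelopes meet and force [q = p]; at the
    dummy goods both prices are 0. A choice optimal under [p] then stays optimal, because the
    envelope bounds keep every competing good unattractive. *)
Lemma equilibrium_price_between p q :
  equilibrium_price X Y Z0 zd zs u v mu nu p -> admissible X Y Z0 zd zs u v q ->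
  (forall z, Z z ->
    psharpsharp X Z0 zd zs u p z <= q z <= pflatflat Y Z0 zd zs v p z) ->
  equilibrium_price X Y Z0 zd zs u v mu nu q.
Proof.
move=> [alpha [beta E]] adq pqp.
have [N [mN NZ0 aN bN HN]] := equilibrium_envelopes_ae E.
case: E => [[psp adp] [np mp] [np' mp'] ab].
have [cp [pd ps]] := psp; have [[cq [qd qs]] _] := adq.
have qp z : Z z -> ~ N z -> q z = p z.
  move=> Zz nN; case: (Zz) => [[Z0z|/= ->]|/= ->]; rewrite ?pd ?ps//.
  have [e1 e2] := HN z Z0z nN; have := pqp z Zz; rewrite e1 -e2 => /le_anti.
  by move=> ->.
exists alpha, beta; split=> //; split=> //.
- have negN : alpha.-negligible (setT `*` N : set (borelType (V1 * V3)%type)).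
    apply/negligibleP => //; rewrite (_ : setT `*` N = snd @^-1` N).
      by apply: borel_preimage => // w; exact: cvg_snd.
    by apply/seteqP; split=> w // [].
  apply: negligibleS (negligibleU np negN) => -[x z] nq.
  apply: contrapT => /not_orP[/contrapT gp nN]; apply: nq.
  apply: (graphD_between cZ0 zds Z0d Z0s cu cp _ gp).
    by move=> z' /pqp/andP[].
  case: gp => _ [Zz _]; apply: qp => // Nz; exact: nN.
- have negN : beta.-negligible (setT `*` N : set (borelType (V2 * V3)%type)).
    apply/negligibleP => //; rewrite (_ : setT `*` N = snd @^-1` N).
      by apply: borel_preimage => // w; exact: cvg_snd.
    by apply/seteqP; split=> w // [].
  apply: negligibleS (negligibleU np' negN) => -[y z] nq.
  apply: contrapT => /not_orP[/contrapT gp nN]; apply: nq.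
  have [_ [Zz _]] := gp; have qpz : q z = p z by apply: qp => // Nz; exact: nN.
  rewrite graphSN// in gp; rewrite graphSN//.
  (* The change of sign turns the upper envelope bound on [q] into a lower envelope bound on
     [- q]. *)
  have pq' z' : Zset Z0 zs zd z' ->
      psharpsharp Y Z0 zs zd nv (\- p) z' <= (\- q) z'.
    by rewrite ZsetC => /pqp/andP[_]; rewrite pflatflatN//= lerNr.
  have qpz' : (\- q) z = (\- p) z by rewrite /= qpz.
  exact: (graphD_between cZ0 zsd Z0s Z0d cnv (price_systemN psp).1 pq' gp qpz').
Qed.

End equilibria.

Theorem mainTheorem2 (R : realType) (d1 d2 d3 : nat)
  (X : set 'rV[R]_d1) (Y : set 'rV[R]_d2) (Z0 : set 'rV[R]_d3)
  (zd zs : 'rV[R]_d3)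
  (mu : {finite_measure set (borelType 'rV[R]_d1) -> \bar R})
  (nu : {finite_measure set (borelType 'rV[R]_d2) -> \bar R})
  (u : 'rV[R]_d1 -> 'rV[R]_d3 -> R) (v : 'rV[R]_d2 -> 'rV[R]_d3 -> R) :
  compact X -> X !=set0 -> compact Y -> Y !=set0 -> compact Z0 ->
  zd <> zs -> ~ Z0 zd -> ~ Z0 zs ->
  mu (~` X : set (borelType 'rV[R]_d1)) = 0%E ->
  nu (~` Y : set (borelType 'rV[R]_d2)) = 0%E ->
  regular_u X Z0 u -> regular_v Y Z0 v ->
  let EqP := equilibrium_price X Y Z0 zd zs u v mu nu in
  [/\ (exists p, EqP p),
      (forall p q (t : R), EqP p -> EqP q -> 0 <= t <= 1 ->
         EqP (fun z => t * p z + (1 - t) * q z)),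
      (forall p q, EqP p -> admissible X Y Z0 zd zs u v q ->
         (forall z, Zset Z0 zd zs z ->
            psharpsharp X Z0 zd zs u p z <= q z <= pflatflat Y Z0 zd zs v p z) ->
         EqP q) &
      (forall p alpha beta, equilibrium X Y Z0 zd zs u v mu nu p alpha beta ->
         let P := fun z => psharpsharp X Z0 zd zs u p z = p z /\
                           p z = pflatflat Y Z0 zd zs v p z in
         ae_on_Z0 Z0 (alphaZ alpha) P /\ ae_on_Z0 Z0 (betaZ beta) P)].
Proof.
move=> cX X0 cY Y0 cZ0 zds Z0d Z0s muX nuY.
move=> [U [_ XU contu _ _]] [U' [_ YU' contv _ _]] EqP.
have cu (w : 'rV[R]_d1 * 'rV[R]_d3) : X w.1 -> Z0 w.2 ->
    {for w, continuous (fun w : 'rV[R]_d1 * 'rV[R]_d3 => u w.1 w.2)}.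
  by move=> Xw Zw; apply: contu; exact: XU.
have cnv (w : 'rV[R]_d2 * 'rV[R]_d3) : Y w.1 -> Z0 w.2 ->
    {for w, continuous (fun w : 'rV[R]_d2 * 'rV[R]_d3 => - v w.1 w.2)}.
  by move=> Yw Zw; apply: cvgN; apply: contv; exact: YU'.
split.
- exact: equilibrium_price_exists.
- move=> p q t; exact: equilibrium_price_convex.
- move=> p q; exact: equilibrium_price_between.
move=> p alpha beta E P.
have [N [mN NZ0 aN bN HN]] :=
  equilibrium_envelopes_ae cX X0 cY Y0 cZ0 zds Z0d Z0s cu cnv E.
by split; exists N; split=> // z [Z0z nP]; apply: contrapT => nN; apply: nP; exact: HN.
Qed.
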